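(* Let $n\ge5$, let $p\ge2$ be even, and let $\boldsymbol\lambda\in K_n$ be such that $G_{\boldsymbol\lambda}$ is isomorphic to the dihedral group $D_p$ of order $2p$. According to the type of $\boldsymbol\lambda$, its multiplicity vector (a vector of length $\frac{p+6}{2}$, formed with $\boldsymbol\lambda$ viewed as an element of that type) is: 1. type mC: $(m,\,m-1,\,m-1,\,m-1)$ for $p=2$; $(2m-1,\,m,\,m-1,\,m,\,m)$ for $p=4$; $(2m-1,\,2m,\dots,2m,\,m,\,m-1,\,m,\,m)$ for $p\ge6$; 2. type A+mC: $(m,\,m,\,m-1,\,m)$ for $p=2$; $(2m,\,m,\,m,\,m,\,m+1)$ for $p=4$; $(2m,\,2m+1,\dots,2m+1,\,m,\,m,\,m,\,m+1)$ for $p\ge6$; 3. type AB+mC: $(m,\,m+1,\,m,\,m)$ for $p=2$; $(2m+1,\,m,\,m+1,\,m+1,\,m+1)$ for $p=4$; $(2m+1,\,2m+2,\dots,2m+2,\,m,\,m+1,\,m+1,\,m+1)$ for $p\ge6$; 4. type 2+mC: $(m,\,m-1,\,m,\,m)$ for $p=2$; $(2m,\dots,2m,\,m,\,m-1,\,m,\,m)$ for $p\ge4$; 5. type A+2+mC: $(m,\,m,\,m,\,m+1)$ for $p=2$; $(2m+1,\dots,2m+1,\,m,\,m,\,m,\,m+1)$ for $p\ge4$; 6. type AB+2+mC: $(m,\,m+1,\,m+1,\,m+1)$ for $p=2$; $(2m+2,\dots,2m+2,\,m,\,m+1,\,m+1,\,m+1)$ for $p\ge4$.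
   Context: $K_n=\{\boldsymbol\lambda=(\lambda^1,\dots,\lambda^{n-3})\in\mathbb{C}^{n-3}\mid \lambda^i\neq 0,1,\ \lambda^i\neq\lambda^j \text{ for } i\neq j\}$. For $\boldsymbol\lambda\in K_n$ put $z^{\boldsymbol\lambda}_1=0$, $z^{\boldsymbol\lambda}_2=1$, $z^{\boldsymbol\lambda}_3=\infty$, $z^{\boldsymbol\lambda}_{i+3}=\lambda^i$, and $[\boldsymbol\lambda]=\{z^{\boldsymbol\lambda}_1,\dots,z^{\boldsymbol\lambda}_n\}\subset\widehat{\mathbb{C}}$. For $\sigma\in S_n$, $f^{\boldsymbol\lambda}_\sigma$ is the unique linear fractional transformation (LFT) sending $z^{\boldsymbol\lambda}_{\sigma^{-1}(1)},z^{\boldsymbol\lambda}_{\sigma^{-1}(2)},z^{\boldsymbol\lambda}_{\sigma^{-1}(3)}$ to $0,1,\infty$, and $g_\sigma:K_n\to K_n$, $g_\sigma(\boldsymbol\lambda)=(f^{\boldsymbol\lambda}_\sigma(z^{\boldsymbol\lambda}_{\sigma^{-1}(4)}),\dots,f^{\boldsymbol\lambda}_\sigma(z^{\boldsymbol\lambda}_{\sigma^{-1}(n)}))$. $G=\{g_\sigma\}$ is a group under composition ($g_\pi g_\sigma=g_{\pi\sigma}$; for $n\ge5$, $\sigma\mapsto g_\sigma$ is injective), $G_{\boldsymbol\lambda}$ is the stabilizer of $\boldsymbol\lambda$ in $G$, $\mathcal{A}_{\alpha}$ is the group of LFTs preserving a set $\alpha$, and $\Phi_{\boldsymbol\lambda}:G_{\boldsymbol\lambda}\to\mathcal{A}_{[\boldsymbol\lambda]}$,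 $g_\sigma\mapsto f^{\boldsymbol\lambda}_\sigma$, is a group isomorphism. $X_{\boldsymbol\lambda}:G_{\boldsymbol\lambda}\to \mathrm{GL}_{n-3}(\mathbb{C})$ is the representation sending $g_\sigma$ to the Jacobian matrix of $g_\sigma$ at $\boldsymbol\lambda$. Types. Two subsets of $\widehat{\mathbb{C}}$ are equivalent if an LFT carries one onto the other. Put $A_p=\{e^{\frac{k}{p}2\pi i}\mid k\in\mathbb{Z}\}$, $B_p=\{e^{\frac{2k+1}{2p}2\pi i}\mid k\in\mathbb{Z}\}$, $C_p(z)=\{ze^{\frac kp2\pi i}\mid k\in\mathbb{Z}\}\cup\{z^{-1}e^{\frac kp2\pi i}\mid k\in\mathbb{Z}\}$ for $z\in\mathbb{C}^*\setminus\{e^{\frac{l}{2p}2\pi i}\mid l\in\mathbb{Z}\}$ (orbits of $\langle z\mapsto e^{2\pi i/p}z,z\mapsto 1/z\rangle$; $C_p(z)$ has order $2p$). Let $C=C_p(a_1)\cup\cdots\cup C_p(a_m)$ be a union of $m$ distinct such orbits. $\boldsymbol\lambda$ is of type mC ($m\ge1$), A+mC ($m\ge0$), AB+mC ($m\ge1$), 2+mC ($m\ge1$), A+2+mC ($m\ge0$), AB+2+mC ($m\ge1$) if $[\boldsymbol\lambda]$ is equivalent, via some LFT $\psi$, to a set $\psi([\boldsymbol\lambda])$ of the form $C$; $A_p\cup C$; $A_p\cup B_p\cup C$; $\{0,\infty\}\cup C$; $A_p\cup\{0,\infty\}\cup C$; $A_p\cup B_p\cup\{0,\infty\}\cup C$,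 respectively; then $\psi\mathcal{A}_{[\boldsymbol\lambda]}\psi^{-1}=\langle z\mapsto e^{2\pi i/p}z,z\mapsto1/z\rangle$. (For $p=2$ the same $\boldsymbol\lambda$ can be viewed as being of several types, and its multiplicity vector may depend on the type.) Multiplicity vector. For $p$ even, $G_{\boldsymbol\lambda}\simeq D_p$ has $\frac{p+6}2$ conjugacy classes: for $1\le l\le\frac p2$, $K^{(l)}$ consists of the rotations by $\frac{2l\pi}p$, i.e. the elements $g$ with $\psi\circ\Phi_{\boldsymbol\lambda}(g)\circ\psi^{-1}(z)=e^{\pm2\pi il/p}z$; $K^{(\frac{p+2}2)}$ is the identity; two classes remain. For types A+mC and A+2+mC, $K^{(\frac{p+4}2)}$ is the remaining class whose elements have two fixed points in $[\boldsymbol\lambda]$, and $K^{(\frac{p+6}2)}$ the remaining class whose elements have no fixed point in $[\boldsymbol\lambda]$. For the other types, $K^{(\frac{p+4}2)}$ and $K^{(\frac{p+6}2)}$ are the two remaining classes in either order (the result does not depend on this). The irreducible representations $X^{(1)},\dots,X^{(\frac{p+6}2)}$ are ordered as follows: for $1\le l\le\frac{p-2}2$, $X^{(l)}$ is two-dimensional with character $2\cos\frac{2kl\pi}p$ on $K^{(k)}$ ($1\le k\le\frac p2$) and $0$ on $K^{(\frac{p+4}2)},K^{(\frac{p+6}2)}$; $X^{(\frac p2)}$ is trivial; $X^{(\frac{p+2}2)},X^{(\frac{p+4}2)},X^{(\frac{p+6}2)}$ are one-dimensional, with values on $K^{(k)}$ ($1\le k\le\frac p2$) equal to $1$, $(-1)^k$,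 $(-1)^k$, respectively, and with values on $(K^{(\frac{p+4}2)},K^{(\frac{p+6}2)})$ equal to $(-1,-1)$, $(1,-1)$, $(-1,1)$, respectively. If $X_{\boldsymbol\lambda}\cong\bigoplus_ja_jX^{(j)}$, the multiplicity vector of $\boldsymbol\lambda$ is $(a_1,\dots,a_{\frac{p+6}2})$. *)

(* Defs.v *)
From HB Require Import structures.
From mathcomp Require Import all_boot all_order all_algebra all_fingroup.
From mathcomp Require Import all_solvable all_field all_character.
From mathcomp Require Import complex.
From mathcomp Require Import ring.
From mathcomp Require Import all_classical all_reals all_analysis.
Import numFieldNormedType.Exports.

Set Implicit Arguments.
Unset Strict Implicit.
Unset Printing Implicit Defensive.

Import Order.TTheory GRing.Theory Num.Theory.

Local Open Scope classical_set_scope.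
Local Open Scope complex_scope.
Local Open Scope ring_scope.

Section LinearFractional.
Variable F : fieldType.
Implicit Types (f h : option F -> option F) (z : option F).

(* The projective line over F is [option F], with [None] the point at infinity. *)
Definition lft (a b c d : F) (z : option F) : option F :=
  match z with
  | Some x => if c * x + d == 0 then None else Some ((a * x + b) / (c * x + d))
  | None => if c == 0 then None else Some (a / c)
  end.

Definition is_LFT (f : option F -> option F) : Prop :=
  exists a b c d : F, a * d - b * c != 0 /\ f = lft a b c d.

Lemma lft_comp (a b c d a' b' c' d' : F) (z : option F) :
  a * d - b * c != 0 -> a' * d' - b' * c' != 0 ->
  lft a b c d (lft a' b' c' d' z) =
  lft (a * a' + b * c') (a * b' + b * d') (c * a' + d * c') (c * b' + d * d') z.
Proof.
move=> D D'; case: z => [x|] /=.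
- have [E|E] := eqVneq (c' * x + d') 0.
    have N : a' * x + b' != 0.
      apply: contra_neq D' => N.
      have [c0|c0] := eqVneq c' 0.
        have d0 : d' = 0 by move: E; rewrite c0 mul0r add0r.
        by rewrite c0 d0; ring.
      have -> : d' = - (c' * x) by apply/eqP; rewrite -addr_eq0 addrC E.
      have -> : b' = - (a' * x) by apply/eqP; rewrite -addr_eq0 addrC N.
      by ring.
    have -> : (c * a' + d * c') * x + (c * b' + d * d') = c * (a' * x + b').
      by transitivity (c * (a' * x + b') + d * (c' * x + d')); [ring | rewrite E mulr0 addr0].
    have -> : (a * a' + b * c') * x + (a * b' + b * d') = a * (a' * x + b').
      by transitivity (a * (a' * x + b') + b * (c' * x + d')); [ring | rewrite E mulr0 addr0].
    rewrite /= mulf_eq0 (negPf N) orbF.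
    by case: eqVneq => // c0; congr Some; field; rewrite c0 N.
  have -> : (c * a' + d * c') * x + (c * b' + d * d')
    = (c * ((a' * x + b') / (c' * x + d')) + d) * (c' * x + d').
    by field.
  have -> : (a * a' + b * c') * x + (a * b' + b * d')
    = (a * ((a' * x + b') / (c' * x + d')) + b) * (c' * x + d').
    by field.
  by rewrite /= mulf_eq0 (negPf E) orbF -mulf_div divff // mulr1.
- have [c0|c0] := eqVneq c' 0.
    have N : a' != 0 by apply: contra_neq D' => ->; rewrite c0; ring.
    rewrite /= c0 !mulr0 !addr0 mulf_eq0 (negPf N) orbF.
    by case: eqVneq => // H; congr Some; field; rewrite H N.
  have -> : c * a' + d * c' = (c * (a' / c') + d) * c' by field.
  have -> : a * a' + b * c' = (a * (a' / c') + b) * c' by field.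
  by rewrite /= mulf_eq0 (negPf c0) orbF -mulf_div divff // mulr1.
Qed.

Lemma is_LFT_id : is_LFT id.
Proof.
exists 1, 0, 0, 1; split; first by rewrite mulr0 subr0 mulr1 oner_neq0.
apply/funext => -[x|] /=; last by rewrite eqxx.
by rewrite mul0r add0r oner_eq0 mul1r addr0 divr1.
Qed.

Lemma is_LFT_comp f h : is_LFT f -> is_LFT h -> is_LFT (f \o h).
Proof.
move=> [a [b [c [d [D ->]]]]] [a' [b' [c' [d' [D' ->]]]]].
exists (a * a' + b * c'), (a * b' + b * d'), (c * a' + d * c'), (c * b' + d * d').
split; last by apply/funext => z /=; rewrite lft_comp.
rewrite [X in X != 0](_ : _ = (a * d - b * c) * (a' * d' - b' * c')); last by ring.
by rewrite mulf_neq0.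
Qed.

Lemma is_LFT_inv f : is_LFT f ->
  exists h, [/\ is_LFT h, cancel f h & cancel h f].
Proof.
move=> [a [b [c [d [D ->]]]]]; exists (lft d (- b) (- c) a).
have D' : d * a - (- b) * (- c) != 0 by rewrite mulrNN mulrC.
have E e (z : option F) : e != 0 -> lft e 0 0 e z = z.
  move=> e0; case: z => [x|] /=; last by rewrite eqxx.
  by rewrite mul0r add0r (negPf e0) addr0 mulrAC divff // mul1r.
split; first by exists d, (- b), (- c), a.
- move=> z; rewrite lft_comp // -[RHS](E (a * d - b * c)) //.
  by congr (lft _ _ _ _ z); ring.
- move=> z; rewrite lft_comp // -[RHS](E (a * d - b * c)) //.
  by congr (lft _ _ _ _ z); ring.
Qed.

Lemma is_LFT_inj f : is_LFT f -> injective f.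
Proof. by move=> /is_LFT_inv[h [_ fK _]]; apply: can_inj fK. Qed.

Lemma is_LFT_exists (z1 z2 z3 : option F) : z1 != z2 -> z1 != z3 -> z2 != z3 ->
  exists f, is_LFT f /\ [/\ f z1 = Some 0, f z2 = Some 1 & f z3 = None].
Proof.
have ne (x y : F) : Some x != Some y -> y - x != 0.
  by move=> H; rewrite subr_eq0 eq_sym; apply: contra_neq H => ->.
case: z1 => [x1|]; case: z2 => [x2|]; case: z3 => [x3|] //.
- move=> /ne n12 /ne n13 /ne n23.
  exists (lft (x2 - x3) (- x1 * (x2 - x3)) (x2 - x1) (- x3 * (x2 - x1))); split.
    exists (x2 - x3), (- x1 * (x2 - x3)), (x2 - x1), (- x3 * (x2 - x1)); split=> //.
    rewrite [X in X != 0](_ : _ = (x3 - x2) * (x2 - x1) * (x3 - x1)); last by ring.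
    by rewrite !mulf_neq0.
  have e1 : (x2 - x1) * x1 + - x3 * (x2 - x1) = - ((x2 - x1) * (x3 - x1)) by ring.
  have e2 : (x2 - x1) * x2 + - x3 * (x2 - x1) = - ((x2 - x1) * (x3 - x2)) by ring.
  have e3 : (x2 - x1) * x3 + - x3 * (x2 - x1) = 0 by ring.
  split; rewrite /= ?e1 ?e2 ?e3 ?eqxx ?oppr_eq0 ?mulf_eq0 ?(negPf n12) ?(negPf n13)
    ?(negPf n23) //=; congr Some.
    by rewrite [X in X / _](_ : _ = 0) ?mul0r //; ring.
  rewrite [X in X / _](_ : _ = - ((x2 - x1) * (x3 - x2))); last by ring.
  by rewrite divff // oppr_eq0 mulf_neq0.
- move=> /ne n12 _ _; exists (lft 1 (- x1) 0 (x2 - x1)); split.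
    by exists 1, (- x1), 0, (x2 - x1); split=> //; rewrite mul1r mulr0 subr0.
  split; rewrite /= ?mul0r ?add0r ?(negPf n12) ?mul1r ?subrr ?mul0r ?divff ?eqxx //.
- move=> _ /ne n13 _; exists (lft 1 (- x1) 1 (- x3)); split.
    exists 1, (- x1), 1, (- x3); split=> //.
    by rewrite [X in X != 0](_ : _ = - (x3 - x1)) ?oppr_eq0 //; ring.
  split; rewrite /= ?mul1r ?subrr ?mul0r ?oner_eq0 ?divr1 ?invr1 ?eqxx //.
  by rewrite subr_eq0 eq_sym -subr_eq0 (negPf n13).
- move=> _ _ /ne n23; exists (lft 0 (x2 - x3) 1 (- x3)); split.
    exists 0, (x2 - x3), 1, (- x3); split=> //.
    by rewrite mul0r sub0r mulr1 opprB.
  have n32 : x2 - x3 != 0 by rewrite -opprB oppr_eq0.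
  split; rewrite /= ?mul1r ?subrr ?oner_eq0 ?mul0r ?add0r ?eqxx ?(negPf n32) ?divff //.
Qed.

Lemma is_LFT_unique f h (z1 z2 z3 : option F) : is_LFT f -> is_LFT h ->
  [/\ f z1 = Some 0, f z2 = Some 1 & f z3 = None] ->
  [/\ h z1 = Some 0, h z2 = Some 1 & h z3 = None] -> f = h.
Proof.
move=> Lf Lh [f1 f2 f3] [h1 h2 h3].
have [k [Lk hK kK]] := is_LFT_inv Lh.
have L := is_LFT_comp Lf Lk.
have E0 : (f \o k) (Some 0) = Some 0 by rewrite /= -{1}h1 hK.
have E1 : (f \o k) (Some 1) = Some 1 by rewrite /= -{1}h2 hK.
have E2 : (f \o k) None = None by rewrite /= -{1}h3 hK.
suff E : f \o k = id by apply/funext => z; rewrite -{1}[z]hK -[LHS]/((f \o k) (h z)) E.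
case: L => a [b [c [d [D E]]]]; rewrite E in E0 E1 E2 *.
move: E2 => /=; case: eqVneq => // c0 _.
have d0 : d != 0 by apply: contra_neq D => ->; rewrite c0; ring.
have a0 : a != 0 by apply: contra_neq D => ->; rewrite c0; ring.
move: E0 => /=; rewrite c0 mul0r add0r (negPf d0) mulr0 add0r => -[] /eqP.
rewrite mulf_eq0 invr_eq0 (negPf d0) orbF => /eqP b0.
move: E1 => /=; rewrite c0 mul0r add0r (negPf d0) mulr1 b0 addr0 => -[] ad.
apply/funext => -[x|] /=; last by rewrite eqxx.
by rewrite mul0r add0r (negPf d0) addr0 mulrAC ad mul1r.
Qed.

End LinearFractional.

Section Configurations.
Variables (F : fieldType) (d : nat).
Implicit Types (lam : 'rV[F]_d) (s t : 'S_(3 + d)).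

(* There are n = 3 + d points, indexed from 0; the first three are 0, 1 and   *)
(* infinity.                                                                  *)
Definition in_K lam : Prop :=
  (forall i, lam 0 i != 0 /\ lam 0 i != 1) /\ injective (fun i => lam 0 i).

Definition base3 (k : 'I_3) : option F := tnth [tuple Some 0; Some 1; None] k.

Definition zpt lam (i : 'I_(3 + d)) : option F :=
  match fintype.split i with
  | inl k => base3 k
  | inr j => Some (lam 0 j)
  end.

Definition points lam : set (option F) := range (zpt lam).

Definition sends_base lam s (f : option F -> option F) : Prop :=
  is_LFT f /\ forall k : 'I_3, f (zpt lam ((s^-1)%g (lshift d k))) = base3 k.

Definition f_ s lam : option F -> option F :=
  @xget {classic option F -> option F} id (sends_base lam s).

Definition g_ s lam : 'rV[F]_d :=
  \row_j odflt 0 (f_ s lam (zpt lam ((s^-1)%g (rshift 3 j)))).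

Lemma zpt_inj lam : in_K lam -> injective (zpt lam).
Proof.
move=> [lam01 lamI] i j; rewrite /zpt.
case: (split_ordP i) => [k ->|k ->]; case: (split_ordP j) => [l ->|l ->].
- rewrite /base3; move: k l.
  do 2! [case=> -[|[|[|//]]] ?]; rewrite !(tnth_nth None) /= => H;
    try (by congr lshift; apply: val_inj); move: H => // -[] /eqP;
    by rewrite ?oner_eq0 // eq_sym oner_eq0.
- rewrite /base3; have [l0 l1] := lam01 l.
  by case: k => -[|[|[|//]]] ?; rewrite (tnth_nth None) //= => -[] /eqP;
    rewrite eq_sym ?(negPf l0) ?(negPf l1).
- rewrite /base3; have [l0 l1] := lam01 k.
  by case: l => -[|[|[|//]]] ?; rewrite (tnth_nth None) //= => -[] /eqP;
    rewrite ?(negPf l0) ?(negPf l1).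
- by move=> -[] /lamI ->.
Qed.

Lemma sends_base_unique lam s f h :
  sends_base lam s f -> sends_base lam s h -> f = h.
Proof.
move=> [Lf Ef] [Lh Eh]; apply: is_LFT_unique Lf Lh _ _.
- split; [exact: (Ef (@Ordinal 3 0 isT)) | exact: (Ef (@Ordinal 3 1 isT))
         | exact: (Ef (@Ordinal 3 2 isT))].
- split; [exact: (Eh (@Ordinal 3 0 isT)) | exact: (Eh (@Ordinal 3 1 isT))
         | exact: (Eh (@Ordinal 3 2 isT))].
Qed.

Lemma f_P lam s : in_K lam -> sends_base lam s (f_ s lam).
Proof.
move=> Klam; suff [f Pf] : exists f, sends_base lam s f.
  by apply: (@xgetPex {classic option F -> option F}); exists f.
have N (k l : 'I_3) : k != l ->
    zpt lam ((s^-1)%g (lshift d k)) != zpt lam ((s^-1)%g (lshift d l)).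
  by apply: contra_neq => /(zpt_inj Klam) /perm_inj /lshift_inj.
have [f [Lf [E0 E1 E2]]] := is_LFT_exists
  (N (@Ordinal 3 0 isT) (@Ordinal 3 1 isT) isT)
  (N (@Ordinal 3 0 isT) (@Ordinal 3 2 isT) isT)
  (N (@Ordinal 3 1 isT) (@Ordinal 3 2 isT) isT).
exists f; split=> // -[[|[|[|//]]] lt3]; rewrite (bool_irrelevance lt3 isT).
- by rewrite E0.
- by rewrite E1.
- by rewrite E2.
Qed.

Lemma f_1 lam : in_K lam -> f_ 1%g lam = id.
Proof.
move=> Klam; apply: sends_base_unique (f_P _ Klam) _; split; first exact: is_LFT_id.
by move=> k; rewrite invg1 perm1 /zpt (unsplitK (inl _ k)).
Qed.

Lemma f_zpt lam s (i : 'I_(3 + d)) : in_K lam -> g_ s lam = lam ->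
  f_ s lam (zpt lam ((s^-1)%g i)) = zpt lam i.
Proof.
move=> Klam Es; have [Lf Ef] := f_P s Klam.
case: (split_ordP i) => [k ->|j ->]; first by rewrite Ef /zpt (unsplitK (inl _ k)).
rewrite {2}/zpt (unsplitK (inr _ j)) -{3}Es mxE.
case E: (f_ s lam _) => [x|] //; exfalso.
have := Ef (@Ordinal 3 2 isT); rewrite -[base3 _]/(@None F) -E.
move=> /(is_LFT_inj Lf) /(zpt_inj Klam) /perm_inj /(congr1 val) /=.
by case: (j : nat).
Qed.

(* Since (s * t)%g is "t after s", the isomorphism from 'S_n to the group of   *)
(* the maps g_sigma under composition is s |-> g_(s^-1); elements s below      *)
(* stand for the maps g_(s^-1).                                                *)
Definition stab_set lam : {set 'S_(3 + d)} := [set s | g_ s^-1%g lam == lam]%SET.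

Lemma stab_group_set lam : in_K lam -> group_set (stab_set lam).
Proof.
move=> Klam; apply/group_setP; split.
  rewrite inE invg1; apply/eqP/rowP => j; rewrite mxE f_1 // invg1 perm1 /zpt.
  by rewrite (unsplitK (inr _ j)).
move=> s t; rewrite !inE => /eqP Es /eqP Et; apply/eqP.
have fE (u : 'S_(3 + d)) i : g_ u^-1%g lam = lam ->
    f_ u^-1%g lam (zpt lam (u i)) = zpt lam i.
  by move=> /(f_zpt i Klam); rewrite invgK.
have E : f_ (s * t)^-1%g lam = f_ s^-1%g lam \o f_ t^-1%g lam.
  apply: sends_base_unique (f_P _ Klam) _; split.
    by apply: is_LFT_comp; [case: (f_P s^-1%g Klam) | case: (f_P t^-1%g Klam)].
  move=> k; rewrite invgK permM /= !fE //.
  by rewrite /zpt (unsplitK (inl _ k)).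
apply/rowP => j; rewrite mxE E invgK permM /= !fE //.
by rewrite /zpt (unsplitK (inr _ j)).
Qed.

Definition stab_group lam (Klam : in_K lam) : {group 'S_(3 + d)} :=
  Group (stab_group_set Klam).

End Configurations.

Section Types.
Variable R : realType.
Local Notation C := R[i].

Definition cis (t : R) : C := cos t +i* sin t.

Definition A_ (p : nat) : set C :=
  [set cis (k%:~R / p%:R * (2 * pi)) | k in [set: int]].

Definition B_ (p : nat) : set C :=
  [set cis ((2 * k + 1)%:~R / (2 * p)%N%:R * (2 * pi)) | k in [set: int]].

Definition C_ (p : nat) (z : C) : set C :=
  [set z * cis (k%:~R / p%:R * (2 * pi)) | k in [set: int]] `|`
  [set z^-1 * cis (k%:~R / p%:R * (2 * pi)) | k in [set: int]].

Definition C_admissible (p : nat) (z : C) : Prop :=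
  z != 0 /\ forall l : int, z <> cis (l%:~R / (2 * p)%N%:R * (2 * pi)).

(* The types mC, A+mC, AB+mC, 2+mC, A+2+mC and AB+2+mC, in this order. *)
Inductive config_type := T_C | T_AC | T_ABC | T_2C | T_A2C | T_AB2C.

Definition min_orbits (T : config_type) : nat :=
  match T with T_AC | T_A2C => 0 | _ => 1 end.

Definition model (T : config_type) (p : nat) (D : set C) : set (option C) :=
  let fin (E : set C) := [set Some w | w in E] in
  let poles := [set Some 0; None] in
  match T with
  | T_C => fin D
  | T_AC => fin (A_ p `|` D)
  | T_ABC => fin (A_ p `|` B_ p `|` D)
  | T_2C => poles `|` fin D
  | T_A2C => fin (A_ p) `|` poles `|` fin D
  | T_AB2C => fin (A_ p `|` B_ p) `|` poles `|` fin D
  end.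

Definition has_type (d : nat) (lam : 'rV[C]_d) (psi : option C -> option C)
    (T : config_type) (p m : nat) : Prop :=
  is_LFT psi /\ (min_orbits T <= m)%N /\
  exists a : 'I_m -> C,
    [/\ forall i, C_admissible p (a i),
        injective (fun i => C_ p (a i)) &
        psi @` points lam = model T p (\bigcup_(i in [set: 'I_m]) C_ p (a i))].

End Types.

Section Multiplicities.
Variables (R : realType) (d : nat) (lam : 'rV[R[i]]_d) (Klam : in_K lam).
Local Notation C := R[i].
Local Notation G := (stab_group Klam).

Definition Phi (s : 'S_(3 + d)) : option C -> option C := f_ s^-1%g lam.

(* [jacobian] acts on row vectors, hence the transposition. *)
Definition X_jac (s : 'S_(3 + d)) : 'M[C]_d := (jacobian (g_ s^-1%g) lam)^T.

Definition rotation (t : R) : option C -> option C := lft (cis t) 0 0 1.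

Definition nb_fixed (s : 'S_(3 + d)) : nat :=
  #|[pred i : 'I_(3 + d) | Phi s (zpt lam i) == zpt lam i]|.

(* K l is only relevant for 1 <= l <= (p + 6) / 2. The equation with           *)
(* [rotation] is psi \o Phi s \o psi^-1 = rotation _, without the inverse.     *)
Definition class_numbering (psi : option C -> option C) (T : config_type)
    (p : nat) (K : nat -> {set 'S_(3 + d)}) : Prop :=
  let q := p./2 in
  [/\ forall l, (1 <= l <= q)%N -> forall s, s \in K l <->
        s \in G /\ exists e : bool, psi \o Phi s =
          rotation ((-1) ^+ e * (2 * pi * l%:R / p%:R)) \o psi,
      K q.+1 = [set 1%g]%SET,
      K q.+2 \in classes G /\ K q.+3 \in classes G,
      forall i j, (1 <= i <= q.+3)%N -> (1 <= j <= q.+3)%N -> K i = K j -> i = j &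
      (T = T_AC \/ T = T_A2C ->
        (forall s, s \in K q.+2 -> nb_fixed s = 2%N) /\
        (forall s, s \in K q.+3 -> nb_fixed s = 0%N))].

Definition irr_numbering (p : nat) (K : nat -> {set 'S_(3 + d)})
    (X : nat -> representation C G) : Prop :=
  let q := p./2 in
  let has_char j deg (rot : nat -> C) (u v : C) :=
    [/\ rdegree (X j) = deg,
        forall k s, (1 <= k <= q)%N -> s \in K k -> \tr (X j s) = rot k,
        forall s, s \in K q.+2 -> \tr (X j s) = u &
        forall s, s \in K q.+3 -> \tr (X j s) = v] in
  [/\ forall j, (1 <= j <= q.+3)%N -> mx_irreducible (X j),
      forall l, (1 <= l <= q.-1)%N ->
        has_char l 2%N (fun k => (2 * cos (2 * k%:R * l%:R * pi / p%:R))%:C) 0 0,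
      rdegree (X q) = 1%N /\ (forall s, s \in G -> X q s = 1%:M) &
      [/\ has_char q.+1 1%N (fun=> 1) (-1) (-1),
          has_char q.+2 1%N (fun k => (-1) ^+ k) 1 (-1) &
          has_char q.+3 1%N (fun k => (-1) ^+ k) (-1) 1]].

(* Outside T_AC and T_A2C the last two classes come in either order, hence the *)
(* quantification over all numberings. [rho] is X_jac as a representation; the *)
(* multiplicity of X j is the (j-1)-th item of [a].                            *)
Definition multiplicity_vector (psi : option C -> option C) (T : config_type)
    (p : nat) (a : seq nat) : Prop :=
  size a = (p + 6)./2 /\
  (exists K, class_numbering psi T p K) /\
  forall K, class_numbering psi T p K ->
  exists X : nat -> representation C G, irr_numbering p K X /\
  exists rho : mx_representation C G d,
    (forall s, s \in G -> rho s = X_jac s) /\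
    mx_rsim rho
      (\big[dadd_grepr/grepr0]_(1 <= j < (size a).+1) muln_grepr (X j) (nth 0%N a j.-1)).

End Multiplicities.

(* Main.v *)
From HB Require Import structures.
Require Import Defs.
From mathcomp Require Import all_boot all_order all_algebra all_fingroup.
From mathcomp Require Import all_solvable all_field all_character.
From mathcomp Require Import complex ring lra zify.
From mathcomp Require Import all_classical all_reals all_analysis.
Import numFieldNormedType.Exports.
Import Order.TTheory GRing.Theory Num.Theory.
Set Implicit Arguments.
Unset Strict Implicit.
Unset Printing Implicit Defensive.

(** The Jacobian matrix of an element of the stabilizer describes its action on
    the tangent space at [lam] of the space of configurations of points modulo
    linear fractional transformations.  This space is the quotient of the sum of
    the tangent lines of the sphere at the points by the three-dimensional space
    of the global vector fields, which move the points without changing the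
    configuration.  So the trace of the matrix is the sum of the multipliers of
    the corresponding linear fractional transformation at the points that it
    fixes, minus the trace on the global vector fields, which is 1 + k + 1 / k
    when k and 1 / k are the multipliers at the two fixed points on the sphere.
    [mxtrace_jac] is this formula; it is obtained by differentiating a cross
    ratio, [g_cross_ratio].

    Conjugated by [psi], the transformations of the stabilizer become the maps
    z |-> w z and z |-> w / z with w ^+ p = 1: these maps preserve the model
    set, there are 2p of them, and 2p is the order of the stabilizer
    ([exists_dihedral_coords]).  All the model sets have one description: 0 and
    infinity both belong or not, and the other points are the z such that z ^+ p
    lies in a finite set L stable under inversion, which contains 1 when A_p
    occurs, -1 when B_p occurs, and two values for each of the m other orbits
    ([has_type_data]).  The number of points is p times the cardinal of L, plus 2
    for the poles, and the reflection z |-> w / z fixes the two square roots of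
    w, which are in the model set when w ^+ (p / 2) is in L.  The traces are
    therefore known ([mxtrace_jac_dih]): the rotation by w <> 1 has trace
    - 1 if the poles belong to the set and - 1 - w - 1 / w otherwise, and a
    reflection has trace 1 or - 1.

    On the other side the irreducible representations are explicit functions of
    w and of the kind of the map ([dihedral_irr]), and the sum of the traces of
    the two-dimensional ones at a rotation by w <> 1 is - 1 - w ^+ (p / 2)
    ([sum_cos]).  With the announced multiplicities both sides have the same
    traces ([tr_jac_sum]), and in characteristic zero equal traces give similar
    representations ([eq_mxtrace_rsim]). *)

Local Open Scope ring_scope.

(** * Representations with equal traces *)

Section TraceDetermines.
Variables (F : fieldType) (gT : finGroupType) (G : {group gT}).
Hypothesis F0 : [pchar F] =i pred0.

Lemma mxtrace_idempotent n (P : 'M[F]_n) :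
  P *m P = P -> \tr P = (\rank P)%:R.
Proof.
move=> PP; have rc : row_base P *m col_base P = 1%:M.
  apply: (row_full_inj (col_base_full P)).
  apply: (row_free_inj (row_base_free P)).
  by rewrite mulmx1 mulmxA mulmx_base -mulmxA mulmx_base.
by rewrite -{1}(mulmx_base P) mxtrace_mulC rc mxtrace1.
Qed.

(** The operator C |-> A C B is the tensor product of A and of the transpose of
    B, so its trace is the product of the two traces. *)
Lemma mxtrace_lin_mx_bimul m n (A : 'M[F]_m) (B : 'M[F]_n)
    (f : {linear 'M[F]_(m, n) -> 'M[F]_(m, n)}) :
  (forall C, f C = A *m C *m B) -> \tr (lin_mx f) = \tr A * \tr B.
Proof.
move=> fE; rewrite /mxtrace (reindex _ (curry_mxvec_bij m n)) /=.
transitivity (\sum_i \sum_j lin_mx f (mxvec_index i j) (mxvec_index i j)).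
  by rewrite pair_bigA /=; apply: eq_bigr => -[i j] _.
rewrite mulr_suml; apply: eq_bigr => i _; rewrite mulr_sumr; apply: eq_bigr => j _.
have -> : lin_mx f (mxvec_index i j) (mxvec_index i j)
  = ((delta_mx 0 (mxvec_index i j) : 'rV[F]_(m * n)) *m lin_mx f) 0 (mxvec_index i j).
  by rewrite -rowE [RHS]mxE.
rewrite -mxvec_delta mul_vec_lin mxvecE fE !mxE.
rewrite (bigD1 j) //= big1 ?addr0 => [|k kj]; last first.
  rewrite mxE big1 ?mul0r // => l _; rewrite mxE (negPf kj) andbF mulr0 //.
rewrite mxE (bigD1 i) //= big1 ?addr0 => [|l li]; last first.
  by rewrite mxE (negPf li) mulr0.
by rewrite mxE !eqxx mulr1.
Qed.

Lemma char0_natr_eq0 n : (n%:R == 0 :> F) = (n == 0)%N.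
Proof. by move/pcharf0P: F0 => ->. Qed.

Lemma char0_pgroup : ([pchar F]^'.-group G)%g.
Proof. by apply/pgroupP => p _ _; rewrite inE /= F0. Qed.

Section Hom.
Variables (m n : nat) (rU : mx_representation F G m) (rV : mx_representation F G n).

(** Average of the conjugates of A over the group: an intertwiner. *)
Definition hom_avg (A : 'M[F]_(m, n)) : 'M[F]_(m, n) :=
  #|G|%:R^-1 *: \sum_(x in G) rU x^-1%g *m A *m rV x.

Fact hom_avg_linear : linear hom_avg.
Proof.
move=> a A B; rewrite /hom_avg scalerA mulrC -scalerA -scalerDr; congr (_ *: _).
rewrite scaler_sumr -big_split; apply: eq_bigr => x _ /=.
by rewrite mulmxDr mulmxDl -scalemxAr -scalemxAl.
Qed.
HB.instance Definition _ :=
  GRing.isSemilinear.Build F 'M[F]_(m, n) 'M[F]_(m, n) _ hom_avg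
   (GRing.semilinear_linear hom_avg_linear).

Let nG0 : #|G|%:R != 0 :> F.
Proof. by rewrite char0_natr_eq0 -lt0n cardG_gt0. Qed.

Lemma hom_avg_hom A x : x \in G -> rU x *m hom_avg A = hom_avg A *m rV x.
Proof.
move=> Gx; rewrite -scalemxAr -scalemxAl; congr (_ *: _).
rewrite mulmx_sumr mulmx_suml (reindex_acts 'R _ Gx) ?astabsR //=.
apply: eq_bigr => y Gy; rewrite !mulmxA.
rewrite -(repr_mxM rU) ?groupV ?groupM // invMg mulKVg.
by rewrite (repr_mxM rV) // !mulmxA.
Qed.

Lemma hom_avg_id A : (forall x, x \in G -> rU x *m A = A *m rV x) -> hom_avg A = A.
Proof.
move=> homA; rewrite /hom_avg (eq_bigr (fun=> A)) => [|x Gx].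
  by rewrite sumr_const -scaler_nat scalerA mulVf // scale1r.
by rewrite -mulmxA -homA // mulmxA -(repr_mxM rU) ?groupV // mulVg repr_mx1 mul1mx.
Qed.

Lemma hom_avg_tr :
  (\rank (lin_mx hom_avg))%:R =
   #|G|%:R^-1 * \sum_(x in G) \tr (rU x^-1%g) * \tr (rV x).
Proof.
(* Averaging is a projector onto the intertwiners, so its rank is its trace. *)
rewrite -mxtrace_idempotent; last first.
  apply/row_matrixP => k; rewrite row_mul [row k _]rowE.
  rewrite -[delta_mx _ _]vec_mxK mul_vec_lin mul_vec_lin /=.
  by rewrite [hom_avg (hom_avg _)]hom_avg_id // => x; apply: hom_avg_hom.
pose f x := mulmxr (rV x) \o mulmx (rU x^-1%g).
have -> : lin_mx hom_avg = #|G|%:R^-1 *: \sum_(x in G) lin_mx (f x).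
  apply/row_matrixP => k; rewrite !rowE -[delta_mx _ _]vec_mxK mul_vec_lin.
  rewrite -scalemxAr mulmx_sumr /= /hom_avg linearZ /= linear_sum.
  by congr (_ *: _); apply: eq_bigr => x _; rewrite mul_vec_lin.
rewrite mxtraceZ; congr (_ * _); rewrite raddf_sum; apply: eq_bigr => x _ /=.
exact: mxtrace_lin_mx_bimul.
Qed.

(** The trace pairing detects intertwiners: it is the trace of the projector
    [hom_avg], hence the dimension of the space of intertwiners. *)
Lemma exists_homP :
  (exists A : 'M[F]_(m, n), A != 0 /\ forall x, x \in G -> rU x *m A = A *m rV x) <->
  \sum_(x in G) \tr (rU x^-1%g) * \tr (rV x) != 0.
Proof.
have -> : (\sum_(x in G) \tr (rU x^-1%g) * \tr (rV x) != 0) = (lin_mx hom_avg != 0).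
  rewrite -mxrank_eq0 -char0_natr_eq0 hom_avg_tr mulf_eq0 invr_eq0.
  by rewrite (negPf nG0).
split=> [[A [A0 homA]]|nz].
  apply: contra_neq A0 => E; rewrite -[A]hom_avg_id //.
  by rewrite -[hom_avg A]mxvecK -mul_vec_lin E mulmx0 linear0.
have [/existsP[k Ak]|/existsPn no] := boolP [exists k, row k (lin_mx hom_avg) != 0].
  exists (hom_avg (vec_mx (delta_mx 0 k))); split; last by move=> x; apply: hom_avg_hom.
  apply: contra_neq Ak => E.
  by rewrite rowE -[delta_mx _ _]vec_mxK mul_vec_lin /= E linear0.
case/eqP: nz; apply/row_matrixP => k; rewrite row0.
by move: (no k); rewrite negbK => /eqP.
Qed.

End Hom.

(** Induction on the degree: a simple submodule of the first representation
    embeds in the second one by [exists_homP], and Maschke's theorem provides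
    complements, which still have equal traces. *)
Lemma eq_mxtrace_rsim n1 n2 (rG1 : mx_representation F G n1)
    (rG2 : mx_representation F G n2) :
  (forall x, x \in G -> \tr (rG1 x) = \tr (rG2 x)) -> mx_rsim rG1 rG2.
Proof.
have [N] := ubnP n1; elim: N n1 n2 rG1 rG2 => // N IH n1 n2 rG1 rG2 leN trE.
have n12 : n1 = n2.
  have := trE 1%g (group1 G); rewrite !repr_mx1 !mxtrace1 => /eqP.
  wlog le12 : n1 n2 {leN IH rG1 rG2 trE} / (n1 <= n2)%N.
    move=> W; case/orP: (leq_total n1 n2) => /W // E H.
    by rewrite E // eq_sym.
  by rewrite -subr_eq0 -opprB oppr_eq0 -natrB // char0_natr_eq0 subn_eq0 => ge;
    apply/eqP; rewrite eqn_leq le12.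
case: (posnP n1) => [n0|n_gt0].
  case: _ / n12 in rG2 trE *; exists 1%:M => // [|x Gx]; first by rewrite row_free_unit unitmx1.
  by rewrite mulmx1 mul1mx; apply/matrixP => i; have := ltn_ord i; rewrite [X in (_ < X)%N]n0.
have nz1 : (1%:M : 'M[F]_n1) != 0 by rewrite -mxrank_eq0 mxrank1 -lt0n.
have [U simU] : exists U, mxsimple rG1 U.
  apply/asboolP; apply: (mxsimple_exists (mxmodule1 rG1) nz1) => -[U simU _].
  by apply/asboolP; exists U.
have modU := mxsimple_module simU.
pose rU := submod_repr modU.
have irrU : mx_irreducible rU by apply/submod_mx_irr.
have hom1 : exists A : 'M[F]_(\rank U, n1), A != 0 /\
    forall x, x \in G -> rU x *m A = A *m rG1 x.
  exists (val_submod 1%:M); split=> [|x Gx].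
    rewrite -mxrank_eq0 val_submod1 mxrank_eq0; by case: simU.
  by rewrite -(val_submodJ modU) // mul1mx [RHS]val_submodE.
have [f [f0 homf]] : exists A : 'M[F]_(\rank U, n2), A != 0 /\
    forall x, x \in G -> rU x *m A = A *m rG2 x.
  apply/exists_homP; move/exists_homP: hom1; congr (_ != 0).
  by apply: eq_bigr => x Gx; rewrite trE.
have freef : row_free f.
  rewrite -kermx_eq0; apply: contraNT f0 => ker0.
  have [_ irr] := iffLR (mx_irrP rU) irrU.
  have /irr/(_ ker0) : mxmodule rU (kermx f).
    apply/mxmoduleP => x Gx; apply/sub_kermxP.
    by rewrite -mulmxA homf // mulmxA mulmx_ker mul0mx.
  rewrite -sub1mx => /sub_kermxP; by rewrite mul1mx => ->.
pose U2 := <<f>>%MS.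
have modU2 : mxmodule rG2 U2.
  rewrite (eqmx_module _ (genmxE _)); apply/mxmoduleP => x Gx.
  by rewrite -homf // submxMl.
have simfU : mx_rsim rU (submod_repr modU2).
  exists (in_submod U2 f); first by rewrite genmxE; move/eqP: freef.
    by rewrite /row_free mxrank_in_submod ?genmxE.
  move=> x Gx; rewrite -in_submodJ ?genmxE ?submx_refl // -homf //.
  by rewrite in_submodE [in RHS]in_submodE mulmxA.
have [W modW defW dxW] := mx_Maschke_pchar rG1 char0_pgroup modU (submx1 U).
have [W2 modW2 defW2 dxW2] := mx_Maschke_pchar rG2 char0_pgroup modU2 (submx1 U2).
have simW : mx_rsim (submod_repr modW) (submod_repr modW2).
  apply: IH => [|x Gx].
    have := mxdirectP dxW; rewrite /= defW mxrank1 => E.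
    have : (0 < \rank U)%N by case: simU => _; rewrite -mxrank_eq0 -lt0n.
    move=> U0; rewrite ltnS in leN; apply: leq_trans leN.
    by apply: leq_trans (eq_leq (esym E)); rewrite -[ltnLHS]add0n ltn_add2r.
  apply: (addrI (\tr (rU x))).
  rewrite (mxtrace_dadd_mod modU modW (mxmodule1 rG1)) //.
  rewrite (mxtrace_rsim simfU) //.
  rewrite (mxtrace_dadd_mod modU2 modW2 (mxmodule1 rG2)) //.
  by rewrite !mxtrace_submod1 // trE.
apply: mx_rsim_trans (mx_rsim_sym (rsim_submod1 (mxmodule1 rG1) (eqmx_refl _))) _.
apply: mx_rsim_trans _ (rsim_submod1 (mxmodule1 rG2) (eqmx_refl _)).
pose RU := Representation (submod_repr modU2).
pose RW := Representation (submod_repr modW2).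
have s1 := @mx_rsim_dadd _ _ _ _ rG1 U W 1%:M RU RW modU modW (mxmodule1 _)
  defW dxW simfU simW.
have s2 := @mx_rsim_dadd _ _ _ _ rG2 U2 W2 1%:M RU RW modU2 modW2 (mxmodule1 _)
  defW2 dxW2 (mx_rsim_refl _) (mx_rsim_refl _).
exact: mx_rsim_trans s1 (mx_rsim_sym s2).
Qed.

Lemma mxtrace_dsum_muln (I : Type) (r : seq I) (X : I -> representation F G) (a : I -> nat) x :
  \tr (mx_repr_of_repr (\big[dadd_grepr/grepr0]_(i <- r) muln_grepr (X i) (a i)) x)
  = \sum_(i <- r) \tr (X i x) *+ a i.
Proof.
have D (r1 r2 : representation F G) : \tr (dadd_grepr r1 r2 x) = \tr (r1 x) + \tr (r2 x).
  by rewrite /= mxtrace_block.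
have Z : \tr ((grepr0 : representation F G) x) = 0 by rewrite /= mxtrace1.
elim: r => [|i r IHr]; first by rewrite !big_nil Z.
rewrite !big_cons D IHr; congr (_ + _); rewrite /muln_grepr.
elim: (a i) => [|k IHk]; first by rewrite big_ord0 Z mulr0n.
by rewrite big_ord_recl D IHk mulrS.
Qed.

End TraceDetermines.

(** * Roots of unity in the complex numbers *)

Section Roots.
Variable R : realType.
Local Notation C := R[i]%C.
Implicit Types (p : nat) (z a : C).

Lemma cis0 : cis (0 : R) = 1.
Proof. by rewrite /cis cos0 sin0. Qed.

Lemma cisD (s t : R) : cis (s + t) = cis s * cis t.
Proof.
rewrite /cis cosD sinD; apply/eqP.
by rewrite eq_complex /= addrC [X in _ && (X == _)]addrC !eqxx.
Qed.

Lemma cis_neq0 (t : R) : cis t != 0.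
Proof.
apply/eqP => H; have := cisD t (- t); rewrite subrr cis0 H mul0r => /eqP.
by rewrite oner_eq0.
Qed.

Lemma cisN (t : R) : cis (- t) = (cis t)^-1.
Proof.
by apply: (mulfI (cis_neq0 t)); rewrite -cisD subrr cis0 divff // cis_neq0.
Qed.

Lemma cis_natmul (t : R) n : cis (n%:R * t) = cis t ^+ n.
Proof.
elim: n => [|n IH]; first by rewrite mul0r cis0.
by rewrite -addn1 natrD mulrDl mul1r cisD IH exprD.
Qed.

Lemma cis_intmul (t : R) (k : int) : cis (k%:~R * t) = cis t ^ k.
Proof.
case: k => n; first by rewrite -pmulrn cis_natmul.
by rewrite NegzE mulrNz mulNr cisN -pmulrn cis_natmul -exprnN.
Qed.

Lemma cisDV (t : R) : cis t + (cis t)^-1 = ((2 * cos t)%:C)%C.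
Proof.
rewrite -cisN /cis cosN sinN; apply/eqP.
by rewrite eq_complex /= subrr eqxx andbT mulr_natl mulr2n.
Qed.

Lemma cis_pi : cis (pi : R) = -1.
Proof. by rewrite /cis cospi sinpi; apply/eqP; rewrite eq_complex /= oppr0 !eqxx. Qed.

(** Doubling the angle, cos t = 1 - 2 sin (t / 2) ^+ 2, and the sine is positive
    on the open interval from 0 to pi. *)
Lemma cis_neq1 (t : R) : 0 < t -> t < 2 * pi -> cis t != 1.
Proof.
move=> t0 t2; rewrite eq_complex /= negb_and; apply/orP; left.
rewrite [t]splitr cosD -!expr2; have := cos2Dsin2 (t / 2).
have s0 : 0 < sin (t / 2).
  by rewrite sin_gt0_pi // divr_gt0 //= ltr_pdivrMr // mulrC.
have : 0 < sin (t / 2) ^+ 2 by rewrite exprn_gt0.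
by move=> ? ?; rewrite lt_eqF //; lra.
Qed.

Definition zeta p : C := cis (2 * pi / p%:R).

Lemma zeta_prim p : (0 < p)%N -> p.-primitive_root (zeta p).
Proof.
move=> p0; have pR : 0 < p%:R :> R by rewrite ltr0n.
have pR0 : p%:R != 0 :> R by rewrite gt_eqF.
rewrite /primitive_root_of_unity p0 /=; apply/forallP => i; apply/eqP.
rewrite unity_rootE -cis_natmul; have [E|ne] := eqVneq i.+1 p.
  rewrite E mulrC divfK // mulr_natl mulr2n cisD cis_pi mulrNN mulr1 eqxx //.
apply/negbTE/cis_neq1.
  by rewrite mulr_gt0 ?ltr0n // divr_gt0 ?mulr_gt0 ?pi_gt0.
rewrite mulrCA -[ltRHS]mulr1 ltr_pM2l ?mulr_gt0 ?pi_gt0 //.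
by rewrite ltr_pdivrMr // mul1r ltr_nat ltn_neqAle ne ltn_ord.
Qed.

Lemma cis_zeta p (k : int) : cis (k%:~R / p%:R * (2 * pi)) = zeta p ^ k.
Proof. by rewrite -cis_intmul -mulrA; congr (cis (_ * _)); rewrite mulrC. Qed.

Lemma unity_root_zeta p z : (0 < p)%N ->
  z ^+ p = 1 <-> exists k : int, z = zeta p ^ k.
Proof.
move=> p0; split=> [/(prim_rootP (zeta_prim p0))[i ->]|[k ->]].
  by exists (i : nat).
by rewrite exprnP exprzAC -exprnP (prim_expr_order (zeta_prim p0)) exp1rz.
Qed.

(** Since [zeta p] is a primitive root, the solutions of an equation z ^+ p = c
    form one orbit under rotation; this turns the sets [A_], [B_] and [C_] into
    conditions on the p-th power. *)
Lemma expf_eq_zeta p z c : (0 < p)%N -> c != 0 ->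
  z ^+ p = c ^+ p <-> exists k : int, z = c * zeta p ^ k.
Proof.
move=> p0 c0; have cp0 : c ^+ p != 0 by rewrite expf_neq0.
have -> : z ^+ p = c ^+ p <-> (z / c) ^+ p = 1.
  rewrite expr_div_n; split=> [->|/(canRL (divfK cp0))]; first by rewrite divff.
  by rewrite mul1r.
rewrite unity_root_zeta //; split=> -[k E]; exists k.
  by rewrite -E mulrC divfK.
by rewrite E mulrC mulKf.
Qed.

Lemma mem_A p z : (0 < p)%N -> A_ p z <-> z ^+ p = 1.
Proof.
move=> p0; rewrite unity_root_zeta //; split=> [[k _ <-]|[k ->]]; exists k => //;
  by rewrite cis_zeta.
Qed.

Lemma mem_B p z : (0 < p)%N -> B_ p z <-> z ^+ p = -1.
Proof.
move=> p0; have pR : p%:R != 0 :> R by rewrite pnatr_eq0 -lt0n.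
pose c : C := cis (pi / p%:R).
have cp : c ^+ p = -1 by rewrite -cis_natmul mulrC divfK // cis_pi.
have E (k : int) : cis ((2 * k + 1)%:~R / (2 * p)%N%:R * (2 * pi)) = c * zeta p ^ k.
  rewrite -cis_zeta -cisD; congr cis.
  by rewrite natrM intrD intrM; field.
rewrite -cp expf_eq_zeta ?cis_neq0 //; split=> [[k _ <-]|[k ->]]; exists k => //.
Qed.

Lemma mem_C p a z : (0 < p)%N -> a != 0 ->
  C_ p a z <-> z ^+ p = a ^+ p \/ z ^+ p = (a ^+ p)^-1.
Proof.
move=> p0 a0; rewrite -exprVn !expf_eq_zeta ?invr_eq0 //.
split=> [[[k _ <-]|[k _ <-]]|[[k ->]|[k ->]]]; [left|right|left|right];
  by exists k; rewrite ?cis_zeta.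
Qed.

Lemma C_admissibleE p a : (0 < p)%N ->
  C_admissible p a <-> a != 0 /\ (a ^+ p) ^+ 2 != 1.
Proof.
move=> p0; have p20 : (0 < 2 * p)%N by rewrite muln_gt0.
have E : (a ^+ p) ^+ 2 = 1 <->
    exists l : int, a = cis (l%:~R / (2 * p)%N%:R * (2 * pi)).
  rewrite -exprM mulnC unity_root_zeta //.
  by split=> -[k ->]; exists k; rewrite cis_zeta.
split=> -[a0 H]; split=> //; first by apply/eqP => /E[l]; exact: H.
by move=> l al; move/eqP: H; apply; apply/E; exists l.
Qed.

(** The solutions of z ^+ p = c, as a sequence so that they can be counted. *)
Definition root_seq p c : seq C := [seq p.-root c * zeta p ^+ k | k <- iota 0 p].

Lemma size_root_seq p c : size (root_seq p c) = p.
Proof. by rewrite size_map size_iota. Qed.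

Lemma root_seqP p c z : (0 < p)%N -> c != 0 -> z \in root_seq p c = (z ^+ p == c).
Proof.
move=> p0 c0; have rc : (p.-root c) ^+ p = c by rewrite rootCK.
have r0 : p.-root c != 0 by apply: contra_neq c0 => E; rewrite -rc E expr0n gtn_eqF.
apply/mapP/eqP => [[k _ ->]|zc].
  by rewrite exprMn rc -exprM mulnC exprM (prim_expr_order (zeta_prim p0)) expr1n mulr1.
have /(prim_rootP (zeta_prim p0))[i E] : (z / p.-root c) ^+ p = 1.
  by rewrite expr_div_n rc zc divff.
exists (i : nat); first by rewrite mem_iota /= add0n.
by rewrite -E mulrC divfK.
Qed.

Lemma root_seq_uniq p c : (0 < p)%N -> c != 0 -> uniq (root_seq p c).
Proof.
move=> p0 c0; have rc : (p.-root c) ^+ p = c by rewrite rootCK.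
have r0 : p.-root c != 0 by apply: contra_neq c0 => E; rewrite -rc E expr0n gtn_eqF.
rewrite map_inj_in_uniq ?iota_uniq // => i j.
rewrite !mem_iota !add0n /= => ip jp /(mulfI r0) /eqP.
by rewrite (eq_prim_root_expr (zeta_prim p0)) !modn_small // => /eqP.
Qed.

End Roots.

(** * Rules of differentiation *)

Section Differential.
Variable K : numFieldType.

(** The differential is local.  The maps [g_] are given by cross ratios only at
    the configurations of distinct points, that is near [lam]. *)
Lemma near_eq_is_diff (V W : normedModType K) (f g dg : V -> W) (x : V) :
  (\forall y \near x, f y = g y) -> is_diff x g dg -> is_diff x f dg.
Proof.
move=> fg dgx; have gx : differentiable g x by [].
have gc : continuous ('d g x) by apply: diff_continuous.
have E : f \o shift x = cst (f x) + 'd g x +o_ 0 id.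
  have /eqaddoP H := diff_locally gx.
  apply/eqaddoP => e e0.
  have fgx : f x = g x by apply: nbhs_singleton fg.
  have fg0 : \forall y \near (0 : V), f (y + x) = g (y + x).
    by move: fg; rewrite (near_shift 0) subr0; apply: filterS.
  apply: filterS2 fg0 (H e e0) => y /= fgy.
  by rewrite /GRing.add /GRing.opp /= fgy fgx.
have dE := diff_unique gc E.
apply: DiffDef; last by rewrite dE; apply: diff_val.
by apply/diff_locallyP; rewrite dE.
Qed.

Lemma is_diff_sum (V W : normedModType K) (I : Type) (r : seq I) (f df : I -> V -> W) (x : V) :
  (forall i, is_diff x (f i) (df i)) -> is_diff x (\sum_(i <- r) f i) (\sum_(i <- r) df i).
Proof.
move=> H; elim: r => [|i r IH]; first by rewrite !big_nil; exact: is_diff_cst.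
by rewrite !big_cons; apply: is_diffD.
Qed.

Lemma is_diff_row (V : normedModType K) n (f df : 'I_n -> V -> K) (x : V) :
  (forall j, is_diff x (f j) (df j)) ->
  is_diff x (fun y => \row_j f j y) (fun v => \row_j df j v).
Proof.
move=> H.
have E (h : 'I_n -> V -> K) :
    (fun y => \row_j h j y) = \sum_(j < n) (fun y => h j y *: (delta_mx 0 j : 'rV[K]_n)).
  apply/funext => y; rewrite fct_sumE; apply/rowP => j; rewrite mxE summxE.
  rewrite (bigD1 j) //= !mxE !eqxx mulr1 big1 ?addr0 // => k kj.
  by rewrite !mxE [j == k]eq_sym (negPf kj) andbF mulr0.
rewrite !E; apply: is_diff_sum => j; have Hj := H j.
apply: DiffDef; first by apply: differentiableZl.
by rewrite diffZl // diff_val.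
Qed.

Lemma is_diff_quot (V : normedModType K) (f g df dg : V -> K) (x : V) :
  g x != 0 -> is_diff x f df -> is_diff x g dg ->
  is_diff x (fun y => f y / g y) (fun v => (df v * g x - f x * dg v) / g x ^+ 2).
Proof.
move=> g0 fx gx.
have gV : is_diff x (fun y => (g y)^-1) (- (g x) ^- 2 \*: dg).
  by apply: DiffDef; [apply: differentiableV | rewrite diffV // diff_val].
apply: (is_diff_eq (is_diffM fx gV)); apply/funext => v.
rewrite -[LHS]/(f x * (- g x ^- 2 * dg v) + (g x)^-1 * df v).
by field.
Qed.
End Differential.

(** * Homogeneous coordinates and cross ratios *)

Section Homogeneous.
Variable K : fieldType.

(** The point of homogeneous coordinates (x : y). *)
Definition proj_pt (x y : K) : option K := if y == 0 then None else Some (x / y).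

Lemma lft_proj_pt (a b c e x y : K) : (x != 0) || (y != 0) ->
  lft a b c e (proj_pt x y) = proj_pt (a * x + b * y) (c * x + e * y).
Proof.
rewrite /proj_pt; have [-> /=|y0 _] := eqVneq y 0.
  rewrite orbF => x0; rewrite !mulr0 !addr0 mulf_eq0 (negPf x0) orbF.
  by case: eqP => // /eqP c0; congr Some; field; rewrite c0 x0.
have -> : c * x + e * y = (c * (x / y) + e) * y by field.
rewrite /=; set D := c * (x / y) + e; rewrite mulf_eq0 (negPf y0) orbF.
by have [//|D0] := eqVneq D 0; congr Some; field; rewrite y0 D0.
Qed.

Lemma proj_pt_eq (x y x' y' : K) : (x != 0) || (y != 0) -> (x' != 0) || (y' != 0) ->
  (proj_pt x y == proj_pt x' y') = (x * y' == x' * y).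
Proof.
rewrite /proj_pt; have [->|y0] := eqVneq y 0; have [->|y0'] := eqVneq y' 0; rewrite ?orbF ?orbT /=.
- by rewrite !mulr0 !eqxx.
- by move=> x0 _; rewrite mulr0 mulf_eq0 (negPf x0) (negPf y0').
- by move=> _ x0; rewrite mulr0 eq_sym [RHS]eq_sym mulf_eq0 (negPf x0) (negPf y0).
- by move=> _ _; rewrite (inj_eq (@Some_inj _)) eqr_div.
Qed.

Lemma proj_pt_scale (x y x' y' : K) : (x != 0) || (y != 0) -> (x' != 0) || (y' != 0) ->
  proj_pt x y = proj_pt x' y' -> exists2 e, e != 0 & x' = e * x /\ y' = e * y.
Proof.
move=> nz nz' /eqP; rewrite proj_pt_eq // => /eqP E.
have [x0|x0] := eqVneq x 0.
  move: nz E; rewrite x0 eqxx mul0r /= => y0 /esym/eqP.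
  rewrite mulf_eq0 (negPf y0) orbF => /eqP x0'; move: nz'; rewrite x0' eqxx /= => y0'.
  by exists (y' / y); [rewrite mulf_neq0 ?invr_eq0 | split; [rewrite mulr0|rewrite divfK]].
have x0' : x' != 0.
  apply: contraTneq nz' => x0'; move: E; rewrite x0' mul0r => /eqP.
  by rewrite mulf_eq0 (negPf x0) /= eqxx negbK.
exists (x' / x); first by rewrite mulf_neq0 ?invr_eq0.
split; first by rewrite divfK.
by apply: (mulfI x0); rewrite E; field.
Qed.

Section Conf.
Variable d : nat.
Implicit Types (lam : 'rV[K]_d) (i : 'I_(3 + d)).

(** Homogeneous coordinates of the points: (0 : 1), (1 : 1), (1 : 0) for the
    first three, and (x : 1) for a free point x.  They are affine functions of
    the configuration. *)
Definition hom_x lam i : K :=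
  match fintype.split i with inl k => (k != 0 :> nat)%:R | inr j => lam 0 j end.
Definition hom_y i : K :=
  match fintype.split i with inl k => (k != 2 :> nat)%:R | inr _ => 1 end.

Lemma hom_neq0 lam i : (hom_x lam i != 0) || (hom_y i != 0).
Proof.
rewrite /hom_x /hom_y; case: fintype.split => [[[|[|[|//]]] ?]|j] /=;
  by rewrite ?oner_eq0 ?orbT.
Qed.

Lemma zpt_proj lam i : zpt lam i = proj_pt (hom_x lam i) (hom_y i).
Proof.
rewrite /zpt /hom_x /hom_y /base3 /proj_pt; case: fintype.split => [[[|[|[|//]]] ?]|j] /=;
  by rewrite ?(tnth_nth None) /= ?oner_eq0 ?eqxx ?divr1.
Qed.

(** The determinant of the coordinates of two points. *)
Definition bracket lam i k := hom_x lam i * hom_y k - hom_x lam k * hom_y i.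

Lemma bracket_eq0 lam i k : (bracket lam i k == 0) = (zpt lam i == zpt lam k).
Proof. by rewrite !zpt_proj proj_pt_eq ?hom_neq0 // subr_eq0. Qed.

Lemma in_KP lam : in_K lam <-> forall i k, i != k -> bracket lam i k != 0.
Proof.
split=> [Klam i k|H]; first by rewrite bracket_eq0; apply: contra_neq => /(zpt_inj Klam).
have inj i k : zpt lam i = zpt lam k -> i = k.
  by move=> /eqP; rewrite -bracket_eq0 => E; apply/eqP; apply: contraTT E => /H.
have z0 : zpt lam (lshift d (@Ordinal 3 0 isT)) = Some 0.
  by rewrite /zpt (unsplitK (inl _ _)).
have z1 : zpt lam (lshift d (@Ordinal 3 1 isT)) = Some 1.
  by rewrite /zpt (unsplitK (inl _ _)).
have zr j : zpt lam (rshift 3 j) = Some (lam 0 j).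
  by rewrite /zpt (unsplitK (inr _ _)).
split=> [j|j k E].
  split; apply/eqP => E.
    have := inj (rshift 3 j) (lshift d (@Ordinal 3 0 isT)).
    by rewrite z0 zr E => /(_ erefl)/eqP; rewrite eq_rlshift.
  have := inj (rshift 3 j) (lshift d (@Ordinal 3 1 isT)).
  by rewrite z1 zr E => /(_ erefl)/eqP; rewrite eq_rlshift.
by apply: (@rshift_inj 3); apply: inj; rewrite !zr E.
Qed.

Definition base_idx (b : nat) (h : (b < 3)%N) : 'I_(3 + d) := lshift d (Ordinal h).

(** The transformation sending three points to 0, 1 and infinity is given by
    their cross ratio with a fourth point; written with determinants of
    homogeneous coordinates it needs no distinction about the point at infinity. *)
Lemma g_cross_ratio lam (s : 'S_(3 + d)) j : in_K lam ->
  let a := s (base_idx (isT : 0 < 3)%N) in let b := s (base_idx (isT : 1 < 3)%N) in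
  let c := s (base_idx (isT : 2 < 3)%N) in let k := s (rshift 3 j) in
  g_ s^-1%g lam 0 j =
    (bracket lam k a * bracket lam b c) / (bracket lam k c * bracket lam b a).
Proof.
move=> Klam a b c k; set A := bracket lam b c; set B := bracket lam b a.
have nab : a != b by rewrite (inj_eq perm_inj) (inj_eq (@lshift_inj _ _)).
have nac : a != c by rewrite (inj_eq perm_inj) (inj_eq (@lshift_inj _ _)).
have nbc : b != c by rewrite (inj_eq perm_inj) (inj_eq (@lshift_inj _ _)).
have nkc : k != c by rewrite (inj_eq perm_inj) eq_rlshift.
have K0 := iffLR (in_KP lam) Klam.
have A0 : A != 0 by apply: K0.
have B0 : B != 0 by apply: K0; rewrite eq_sym.
have brii i : bracket lam i i = 0 by rewrite /bracket subrr.
pose f := lft (hom_y a * A) (- hom_x lam a * A) (hom_y c * B) (- hom_x lam c * B).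
have fE i : f (zpt lam i) = proj_pt (bracket lam i a * A) (bracket lam i c * B).
  rewrite zpt_proj /f lft_proj_pt ?hom_neq0 //; congr proj_pt; rewrite /bracket; ring.
have Ef : f_ s^-1%g lam = f.
  apply: sends_base_unique (f_P _ Klam) _; split.
    exists (hom_y a * A), (- hom_x lam a * A), (hom_y c * B), (- hom_x lam c * B).
    split=> //.
    have -> : hom_y a * A * (- hom_x lam c * B) - - hom_x lam a * A * (hom_y c * B) =
        A * B * bracket lam a c.
      by rewrite /bracket; ring.
    by rewrite !mulf_neq0 // K0.
  move=> i; rewrite invgK fE /proj_pt.
  case: i => [[|[|[|//]]] lti] /=; rewrite (bool_irrelevance lti isT).
  - rewrite -/(base_idx _) -/a brii mul0r mulf_eq0 (negPf B0) orbF.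
    by rewrite (negPf (K0 a c nac)) mul0r.
  - rewrite -/(base_idx _) -/b -/A -/B mulf_eq0 (negPf A0) (negPf B0) /=.
    by rewrite [B * A]mulrC divff ?mulf_neq0.
  - by rewrite -/(base_idx _) -/c brii mul0r eqxx.
rewrite mxE invgK Ef fE /proj_pt mulf_eq0 (negPf B0) orbF (negPf (K0 k c nkc)) /=.
by rewrite /A /B.
Qed.

End Conf.
End Homogeneous.

(** * The differential of the action on configurations *)

Section Tangent.
Variables (K : numFieldType) (d : nat).
Implicit Types (lam v : 'rV[K]_d) (i : 'I_(3 + d)) (s t : 'S_(3 + d)).

(** The derivative of [hom_x] in the direction v; [hom_y] is constant. *)
Definition dhom_x v i : K :=
  match fintype.split i with inl _ => 0 | inr j => v 0 j end.

Lemma is_diff_coord lam j : is_diff lam (fun v => v 0 j) (fun v => v 0 j).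
Proof.
pose f (v : 'rV[K]_d) : K := v 0 j.
have fl : linear f by move=> a u v; rewrite /f !mxE.
pose fM := GRing.isLinear.Build _ _ _ _ _ fl.
pose fL : {linear _ -> _} := HB.pack f fM.
have fc : continuous fL by exact: coord_continuous.
by apply: DiffDef; [exact: (linear_differentiable (f := fL)) | exact: (diff_lin (f := fL))].
Qed.

Lemma is_diff_bracket lam i k :
  is_diff lam (fun l => bracket l i k)
    (fun v => dhom_x v i * hom_y K k - dhom_x v k * hom_y K i).
Proof.
have hom_x_diff m : is_diff lam (fun l => hom_x l m) (fun v => dhom_x v m).
  rewrite /hom_x /dhom_x; case: fintype.split => [c|j]; last exact: is_diff_coord.
  exact: (is_diff_cst ((c != 0 :> nat)%:R : K) lam).
have hom_x_diffM m c : is_diff lam (fun l => hom_x l m * c) (fun v => dhom_x v m * c).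
  have -> : (fun l => hom_x l m * c) = (fun l => c * hom_x l m).
    by apply/funext => l; rewrite mulrC.
  have -> : (fun v => dhom_x v m * c) = (fun v => c * dhom_x v m).
    by apply/funext => l; rewrite mulrC.
  exact: (is_diffZ c (hom_x_diff m)).
exact: is_diffB.
Qed.

(** Being a configuration of distinct points is an open condition: finitely many
    determinants do not vanish. *)
Lemma in_K_near lam : in_K lam -> \forall l \near lam, in_K l.
Proof.
move=> Klam; have K0 := iffLR (in_KP lam) Klam.
have H (ik : 'I_(3 + d) * 'I_(3 + d)) :
    \forall l \near lam, ik.1 != ik.2 -> bracket l ik.1 ik.2 != 0.
  case: ik => i k /=; have [_|ik] := eqVneq i k; first by near=> l.
  have bc : {for lam, continuous (fun l : 'rV[K]_d => bracket l i k)}.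
    by apply: differentiable_continuous; have := is_diff_bracket lam i k.
  by apply: filterS (cvgr_neq0 _ bc (K0 _ _ ik)).
apply: filterS (filter_forall _ H) => l Hl; apply/in_KP => i k ik.
exact: (Hl (i, k)).
Unshelve. all: by end_near. Qed.

Lemma zpt_g lam s i : in_K lam ->
  zpt (g_ s^-1%g lam) i = f_ s^-1%g lam (zpt lam (s i)).
Proof.
move=> Klam; have [Lf Ef] := f_P s^-1%g Klam.
case: (split_ordP i) => [k ->|j ->].
  by have := Ef k; rewrite invgK => ->; rewrite /zpt (unsplitK (inl _ k)).
rewrite {1}/zpt (unsplitK (inr _ j)) mxE invgK.
case E: (f_ s^-1%g lam _) => [x|] //; exfalso.
have := Ef (@Ordinal 3 2 isT); rewrite -[base3 K _]/(@None K) -E invgK.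
move=> /(is_LFT_inj Lf) /(zpt_inj Klam) /perm_inj /(congr1 val) /=.
by case: (j : nat).
Qed.

Lemma in_K_g lam s : in_K lam -> in_K (g_ s^-1%g lam).
Proof.
move=> Klam; apply/in_KP => i k ik; rewrite bracket_eq0 !zpt_g //.
have [Lf _] := f_P s^-1%g Klam.
by rewrite (inj_eq (is_LFT_inj Lf)) (inj_eq (zpt_inj Klam)) (inj_eq perm_inj).
Qed.

(** Both sides send the same three points to 0, 1 and infinity. *)
Lemma f_comp lam s t : in_K lam ->
  f_ (s * t)^-1%g lam = f_ s^-1%g (g_ t^-1%g lam) \o f_ t^-1%g lam.
Proof.
move=> Klam; have Kt := in_K_g t Klam.
have [Ls Es] := f_P s^-1%g Kt; have [Lt Et] := f_P t^-1%g Klam.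
apply: sends_base_unique (f_P _ Klam) _; split; first exact: is_LFT_comp.
by move=> k; have := Es k; rewrite !invgK permM /= -zpt_g // -zpt_g // -zpt_g.
Qed.

Lemma g_comp lam s t : in_K lam ->
  g_ (s * t)^-1%g lam = g_ s^-1%g (g_ t^-1%g lam).
Proof.
by move=> Klam; apply/rowP => j; rewrite !mxE f_comp //= !invgK permM -zpt_g.
Qed.

Lemma g_1 lam : in_K lam -> g_ 1%g lam = lam.
Proof.
move=> Klam; apply/rowP => j.
by rewrite mxE f_1 // invg1 perm1 /zpt (unsplitK (inr _ j)).
Qed.

(** The quotient rule applied to [g_cross_ratio]. *)
Definition d_cross_ratio s lam v : 'rV[K]_d := \row_j
  let a := s (base_idx d (isT : 0 < 3)%N) in let b := s (base_idx d (isT : 1 < 3)%N) in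
  let c := s (base_idx d (isT : 2 < 3)%N) in let k := s (rshift 3 j) in
  let db i k := dhom_x v i * hom_y K k - dhom_x v k * hom_y K i in
  ((bracket lam k a * db b c + bracket lam b c * db k a) * (bracket lam k c * bracket lam b a)
   - bracket lam k a * bracket lam b c * (bracket lam k c * db b a + bracket lam b a * db k c))
   / (bracket lam k c * bracket lam b a) ^+ 2.

Lemma is_diff_g lam s : in_K lam -> is_diff lam (g_ s^-1%g) (d_cross_ratio s lam).
Proof.
move=> Klam.
apply: (near_eq_is_diff (g := fun l => \row_j (
  let a := s (base_idx d (isT : 0 < 3)%N) in let b := s (base_idx d (isT : 1 < 3)%N) in
  let c := s (base_idx d (isT : 2 < 3)%N) in let k := s (rshift 3 j) in
    (bracket l k a * bracket l b c) / (bracket l k c * bracket l b a)))).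
  apply: filterS (in_K_near Klam) => l Kl; apply/rowP => j.
  by rewrite [LHS]g_cross_ratio // mxE.
apply: is_diff_row => j /=.
set a := s (base_idx _ _); set b := s (base_idx _ _); set c := s (base_idx _ _).
set k := s _.
have K0 := iffLR (in_KP lam) Klam.
apply: (is_diff_quot (f := (fun l => bracket l k a) * (fun l => bracket l b c))
  (g := (fun l => bracket l k c) * (fun l => bracket l b a))
  (df := fun v => bracket lam k a * (dhom_x v b * hom_y K c - dhom_x v c * hom_y K b)
                  + bracket lam b c * (dhom_x v k * hom_y K a - dhom_x v a * hom_y K k))
  (dg := fun v => bracket lam k c * (dhom_x v b * hom_y K a - dhom_x v a * hom_y K b)
                  + bracket lam b a * (dhom_x v k * hom_y K c - dhom_x v c * hom_y K k))).
- rewrite -[_ lam]/(bracket lam k c * bracket lam b a) mulf_neq0 // K0 //.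
    by rewrite (inj_eq perm_inj) eq_rlshift.
  by rewrite (inj_eq perm_inj) (inj_eq (@lshift_inj _ _)).
- exact: is_diffM (is_diff_bracket _ _ _) (is_diff_bracket _ _ _).
- exact: is_diffM (is_diff_bracket _ _ _) (is_diff_bracket _ _ _).
Qed.

End Tangent.

(** * The trace of the Jacobian matrix *)

Section Jac.
Variables (K : numFieldType) (d : nat) (lam : 'rV[K]_d) (Klam : in_K lam).
Implicit Types (s t : 'S_(3 + d)).

Definition jac s : 'M[K]_d := (jacobian (g_ s^-1%g) lam)^T.

Lemma mul_jacobian s v : v *m jacobian (g_ s^-1%g) lam = d_cross_ratio s lam v.
Proof.
have gd := is_diff_g s Klam.
by rewrite /jacobian mul_rV_lin1 diff_val.
Qed.

Lemma jac1 : jac 1%g = 1%:M.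
Proof.
rewrite -trmx1; congr trmx; apply/row_matrixP => i.
have gd : is_diff lam (g_ 1%g) id.
  apply: near_eq_is_diff (is_diff_id lam).
  by apply: filterS (in_K_near Klam) => l; apply: g_1.
by rewrite rowE /jacobian mul_rV_lin1 invg1 diff_val row1.
Qed.

(** The chain rule for [g_comp], at a configuration fixed by [g_ t^-1]. *)
Lemma jacM s t : g_ t^-1%g lam = lam -> jac (s * t)%g = jac s *m jac t.
Proof.
move=> Et; rewrite -trmx_mul; congr trmx; apply/row_matrixP => i.
have gs := is_diff_g s Klam; have gt := is_diff_g t Klam.
have gst : is_diff lam (g_ (s * t)^-1%g) (d_cross_ratio s lam \o d_cross_ratio t lam).
  apply: (near_eq_is_diff (g := g_ s^-1%g \o g_ t^-1%g)).
    by apply: filterS (in_K_near Klam) => l; apply: g_comp.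
  by apply: is_diff_comp; rewrite Et.
rewrite !rowE {1}/jacobian mul_rV_lin1 diff_val mulmxA !mul_jacobian.
by [].
Qed.

Section Trace.
(** The matrix (p q; r t) is that of a transformation moving the points by the
    permutation [s], and [e i] is the factor between the chosen coordinates of
    the point [s i] and the image of those of the point [i]. *)
Variables (s : 'S_(3 + d)) (p q r t : K) (e : 'I_(3 + d) -> K).
Let D := p * t - q * r.
Hypothesis D0 : D != 0.
Hypothesis e0 : forall i, e i != 0.
Hypothesis es : forall i, hom_x lam (s i) = e i * (p * hom_x lam i + q * hom_y K i) /\
                          hom_y K (s i) = e i * (r * hom_x lam i + t * hom_y K i).

(** When [s i = i] this is the multiplier at the point [i] of the inverse
    transformation. *)
Let kappa i := (D * e i ^+ 2)^-1.

Let b0 : 'I_(3 + d) := base_idx d (isT : 0 < 3)%N.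
Let b1 : 'I_(3 + d) := base_idx d (isT : 1 < 3)%N.
Let b2 : 'I_(3 + d) := base_idx d (isT : 2 < 3)%N.

(** The quadratic forms equal to 1 at one of the three base points and to 0 at
    the two others.  A quadratic form is a global vector field; subtracting
    multiples of these three brings any tangent vector back to the slice where
    the base points do not move. *)
Let Q0 i := hom_y K i * (hom_y K i - hom_x lam i).
Let Q1 i := hom_x lam i * hom_y K i.
Let Q2 i := hom_x lam i * (hom_x lam i - hom_y K i).

Lemma dhom_x_y (v : 'rV[K]_d) i : dhom_x v i * hom_y K i = dhom_x v i.
Proof. by rewrite /dhom_x /hom_y; case: fintype.split => k; rewrite ?mul0r ?mulr1. Qed.

Lemma hom_x_base b (h : (b < 3)%N) : hom_x lam (base_idx d h) = (b != 0)%:R.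
Proof. by rewrite /hom_x /base_idx (unsplitK (inl _ _)). Qed.
Lemma hom_y_base b (h : (b < 3)%N) : hom_y K (base_idx d h) = (b != 2)%:R.
Proof. by rewrite /hom_y /base_idx (unsplitK (inl _ _)). Qed.
Lemma hom_x_free j : hom_x lam (rshift 3 j) = lam 0 j.
Proof. by rewrite /hom_x (unsplitK (inr _ _)). Qed.
Lemma hom_y_free j : hom_y K (rshift 3 j : 'I_(3 + d)) = 1.
Proof. by rewrite /hom_y (unsplitK (inr _ _)). Qed.

(** Transport by the transformation, followed by the projection onto the slice
    along the global vector fields. *)
Lemma d_cross_ratioE v j : d_cross_ratio s lam v 0 j =
  kappa (rshift 3 j) * dhom_x v (s (rshift 3 j))
  - kappa b0 * (dhom_x v (s b0) * Q0 (rshift 3 j))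
  - kappa b1 * (dhom_x v (s b1) * Q1 (rshift 3 j))
  - kappa b2 * (dhom_x v (s b2) * Q2 (rshift 3 j)).
Proof.
have [xa ya] := es b0; have [xb yb] := es b1; have [xc yc] := es b2.
have [xk yk] := es (rshift 3 j).
have [? ? ? ?] := (@And4 _ _ _ _ (e0 b0) (e0 b1) (e0 b2) (e0 (rshift 3 j))).
(* Only free points move and their second coordinate is 1; the identity is
   homogeneous in the coordinates of the points only with this factor. *)
have E i : dhom_x v (s i) = dhom_x v (s i) * hom_y K (s i) by rewrite dhom_x_y.
rewrite mxE /bracket -/b0 -/b1 -/b2.
rewrite [in RHS](E b0) [in RHS](E b1) [in RHS](E b2) [in RHS](E (rshift 3 j)) /=.
rewrite /kappa /Q0 /Q1 /Q2 hom_x_free hom_y_free.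
rewrite hom_x_free hom_y_free in xk yk; rewrite hom_x_base hom_y_base /= in xa ya;
rewrite hom_x_base hom_y_base /= in xb yb; rewrite hom_x_base hom_y_base /= in xc yc.
move: (dhom_x v _) (dhom_x v _) (dhom_x v _) (dhom_x v _) => wk wa wb wc.
rewrite xa xb xc xk ya yb yc yk /D.
have D0' : p * t - q * r != 0 by [].
field; rewrite D0'; apply/and5P; split=> //; apply/and3P; split=> //.
  rewrite [X in X != 0](_ : _ = e b1 * e b0 * (p * t - q * r)); last by ring.
  by rewrite !mulf_neq0.
rewrite [X in X != 0](_ : _ = - (e (rshift 3 j) * e b2 * (p * t - q * r))); last by ring.
by rewrite oppr_eq0 !mulf_neq0.
Qed.

Lemma sum_dhom_x (Q : 'I_(3 + d) -> K) i b (h : (b < 3)%N) :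
  (forall c (h' : (c < 3)%N), Q (base_idx d h') = (c == b)%:R) ->
  \sum_j dhom_x (delta_mx 0 j : 'rV[K]_d) i * Q (rshift 3 j) = Q i - (i == base_idx d h)%:R.
Proof.
move=> HQ; rewrite /dhom_x; case: (split_ordP i) => [[c hc] ->|k ->].
  rewrite big1 => [|j _]; last by rewrite mul0r.
  rewrite -/(base_idx d hc) HQ /base_idx (inj_eq (@lshift_inj _ _)) -val_eqE /=.
  by rewrite subrr.
rewrite (bigD1 k) //= mxE !eqxx mul1r big1 ?addr0.
  by rewrite /base_idx eq_rlshift subr0.
by move=> j jk; rewrite mxE [k == j]eq_sym (negPf jk) mul0r.
Qed.

(** The first sum is the trace of the transport of tangent vectors at all the
    points, where the fixed points alone contribute; the other terms are the
    trace on quadratic forms, computed in the basis [Q0], [Q1], [Q2] by [I0],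
    [I1] and [I2] below. *)
Lemma mxtrace_jac : \tr (jac s) =
  \sum_(i | s i == i) kappa i - (p + t) ^+ 2 / D + 1.
Proof.
rewrite /jac mxtrace_tr /mxtrace.
have -> : \sum_j jacobian (g_ s^-1%g) lam j j =
    \sum_j d_cross_ratio s lam (delta_mx 0 j) 0 j.
  by apply: eq_bigr => j _; rewrite -mul_jacobian -rowE [RHS]mxE.
under eq_bigr do rewrite d_cross_ratioE.
rewrite !sumrB -!mulr_sumr.
rewrite (sum_dhom_x (Q := Q0) (s b0) (isT : (0 < 3)%N)); last first.
  by move=> [|[|[|//]]] h /=; rewrite /Q0 hom_x_base hom_y_base /=; ring.
rewrite (sum_dhom_x (Q := Q1) (s b1) (isT : (1 < 3)%N)); last first.
  by move=> [|[|[|//]]] h /=; rewrite /Q1 hom_x_base hom_y_base /=; ring.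
rewrite (sum_dhom_x (Q := Q2) (s b2) (isT : (2 < 3)%N)); last first.
  by move=> [|[|[|//]]] h /=; rewrite /Q2 hom_x_base hom_y_base /=; ring.
have -> : \sum_j kappa (rshift 3 j) * dhom_x (delta_mx 0 j : 'rV[K]_d) (s (rshift 3 j))
    = \sum_(j < d) (if s (rshift 3 j) == rshift 3 j then kappa (rshift 3 j) else 0).
  apply: eq_bigr => j _; rewrite /dhom_x.
  case: (split_ordP (s (rshift 3 j))) => [k E|k E]; rewrite E.
    by rewrite eq_lrshift mulr0.
  rewrite mxE eqxx (inj_eq (@rshift_inj _ _)) eq_sym.
  by rewrite eq_sym; case: eqP => _; rewrite ?mulr1 ?mulr0.
rewrite [in RHS]big_mkcond big_split_ord /= !big_ord_recl big_ord0 /=.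
have -> : lshift d ord0 = b0 by apply: val_inj.
have -> : lshift d (lift ord0 (ord0 : 'I_2)) = b1 by apply: val_inj.
have -> : lshift d (lift ord0 (lift ord0 (ord0 : 'I_1))) = b2 by apply: val_inj.
have I0 : kappa b0 * Q0 (s b0) = t * (t - q) / D.
  have [xa ya] := es b0; rewrite /kappa /Q0 xa ya hom_x_base hom_y_base /=.
  by field; rewrite e0 D0.
have I1 : kappa b1 * Q1 (s b1) = (p + q) * (r + t) / D.
  have [xa ya] := es b1; rewrite /kappa /Q1 xa ya hom_x_base hom_y_base /=.
  by field; rewrite e0 D0.
have I2 : kappa b2 * Q2 (s b2) = p * (p - r) / D.
  have [xa ya] := es b2; rewrite /kappa /Q2 xa ya hom_x_base hom_y_base /=.
  by field; rewrite e0 D0.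
rewrite !mulrBr I0 I1 I2.
have Z (i : 'I_(3 + d)) : (if s i == i then kappa i else 0) = kappa i * (s i == i)%:R.
  by case: eqP; rewrite ?mulr1 ?mulr0.
rewrite !Z.
set S := \sum_(i < d) _; move: S => S.
have -> : base_idx d (isT : (0 < 3)%N) = b0 by [].
have -> : base_idx d (isT : (1 < 3)%N) = b1 by [].
have -> : base_idx d (isT : (2 < 3)%N) = b2 by [].
move: (kappa b0 * _) (kappa b1 * _) (kappa b2 * _) => k0 k1 k2.
by rewrite /D; field.
Qed.

End Trace.
End Jac.

(** * Groups of rotations and reflections *)

Section DihedralCoordinates.
Variables (F : fieldType) (gT : finGroupType) (G : {group gT}) (p : nat).

(** The element [s] behaves as the map z |-> w s * z when [e s] is false, and as
    z |-> w s / z when [e s] is true; every p-th root of unity occurs. *)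
Record dihedral_coords (e : gT -> bool) (w : gT -> F) : Prop := DihedralCoords {
  coord_root : forall s, s \in G -> w s ^+ p = 1;
  coord_reflM : forall s t, s \in G -> t \in G -> e (s * t)%g = e s (+) e t;
  coord_rootM : forall s t, s \in G -> t \in G ->
    w (s * t)%g = w s * (if e s then (w t)^-1 else w t);
  coord_inj : forall s t, s \in G -> t \in G -> e s = e t -> w s = w t -> s = t;
  coord_surj : forall b z, z ^+ p = 1 -> exists2 s, s \in G & e s = b /\ w s = z }.

Variables (e : gT -> bool) (w : gT -> F).
Hypothesis ew : dihedral_coords e w.
Variable q : nat.
Hypothesis (q0 : (0 < q)%N) (pq : p = q.*2).

Let p0 : (0 < p)%N. Proof. by rewrite pq double_gt0. Qed.

Lemma coord_neq0 s : s \in G -> w s != 0.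
Proof.
move=> /(coord_root ew) E; apply/eqP => w0; move/eqP: E.
by rewrite w0 expr0n gtn_eqF // eq_sym oner_eq0.
Qed.

Lemma coord_refl1 : e 1%g = false.
Proof.
by have := coord_reflM ew (group1 G) (group1 G); rewrite mulg1; case: (e 1%g).
Qed.

Lemma coord_root1 : w 1%g = 1.
Proof.
have := coord_rootM ew (group1 G) (group1 G); rewrite mulg1 coord_refl1.
by move/esym/(canRL (mulfK (coord_neq0 (group1 G)))); rewrite divff ?coord_neq0.
Qed.

Lemma coord_half s : s \in G -> w s ^+ q = 1 \/ w s ^+ q = -1.
Proof.
move=> /(coord_root ew) E; have /eqP : (w s ^+ q) ^+ 2 = 1.
  by rewrite -exprM muln2 -pq.
by rewrite sqrf_eq1 => /orP[] /eqP ->; [left|right].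
Qed.

Lemma coord_halfV s : s \in G -> (w s)^-1 ^+ q = w s ^+ q.
Proof. by move=> Gs; rewrite exprVn; case: (coord_half Gs) => ->; rewrite ?invr1 ?invrN1. Qed.

Section Linear.
Variable chi : gT -> F.
Hypothesis chi1 : chi 1%g = 1.
Hypothesis chiM : {in G &, {morph chi : s t / (s * t)%g >-> s * t}}.

Fact linear_mx_repr : mx_repr G (fun s => (chi s)%:M : 'M[F]_1).
Proof. by split=> [|s t Gs Gt]; rewrite ?chi1 // chiM // scalar_mxM. Qed.

Definition linear_repr := Representation (MxRepresentation linear_mx_repr).

Lemma linear_repr_irr : mx_irreducible linear_repr.
Proof. by apply/mx_abs_irrW/linear_mx_abs_irr. Qed.

Lemma linear_repr_tr s : \tr (linear_repr s) = chi s.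
Proof. by rewrite /= mxtrace_scalar. Qed.

End Linear.

Definition chi_sign s : F := (-1) ^+ e s.
(** As w ^+ p = 1, the power w ^+ q is a sign, insensitive to inversion. *)
Definition chi_par (eps : F) s : F := w s ^+ q * eps ^+ e s.

Lemma chi_sign1 : chi_sign 1%g = 1.
Proof. by rewrite /chi_sign coord_refl1. Qed.
Lemma chi_signM : {in G &, {morph chi_sign : s t / (s * t)%g >-> s * t}}.
Proof. by move=> s t Gs Gt; rewrite /chi_sign (coord_reflM ew) // signr_addb. Qed.

Lemma chi_par1 eps : chi_par eps 1%g = 1.
Proof. by rewrite /chi_par coord_refl1 coord_root1 expr1n mulr1. Qed.
Lemma chi_parM eps : eps ^+ 2 = 1 ->
  {in G &, {morph chi_par eps : s t / (s * t)%g >-> s * t}}.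
Proof.
move=> eps2 s t Gs Gt; rewrite /chi_par (coord_reflM ew) // (coord_rootM ew) // exprMn.
have -> : (if e s then (w t)^-1 else w t) ^+ q = w t ^+ q by case: (e s); rewrite ?coord_halfV.
by case: (e s) (e t) => -[] /=; rewrite ?expr1 ?expr0 ?mulr1 ?mul1r //;
  rewrite -1?mulrA -1?[RHS]mulrA // [eps * _]mulrC -?mulrA -?expr2 ?eps2 ?mulr1.
Qed.

(** The action of z |-> w z or z |-> w / z on the span of z and 1 / z. *)
Definition rot_mx (b : bool) (z : F) : 'M[F]_2 :=
  \matrix_(i, j) (if (i == j) (+) b then (if i == 0 then z else z^-1) else 0).

Lemma rot_mxM b c z y : rot_mx b z *m rot_mx c y =
  rot_mx (b (+) c) (z * if b then y^-1 else y).
Proof.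
apply/matrixP => i j; rewrite !mxE !big_ord_recl big_ord0 !mxE.
by case: b; case: c; case: i => -[|[|//]] ?; case: j => -[|[|//]] ? /=;
  rewrite ?mulr0 ?mul0r ?addr0 ?add0r ?invfM ?invrK.
Qed.

Fact rot_mx_repr l : mx_repr G (fun s => rot_mx (e s) (w s ^+ l)).
Proof.
split=> [|s t Gs Gt].
  rewrite coord_refl1 coord_root1 expr1n; apply/matrixP => i j; rewrite !mxE invr1 addbF.
  by case: eqP => //; case: eqP.
rewrite rot_mxM (coord_reflM ew) // (coord_rootM ew) // exprMn.
by case: (e s); rewrite ?exprVn.
Qed.

Definition rot_mx_representation l : mx_representation F G 2 :=
  MxRepresentation (rot_mx_repr l).
Definition rot_repr l := Representation (rot_mx_representation l).

Lemma rot_repr_tr l s :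
  \tr (rot_repr l s) = if e s then 0 else w s ^+ l + (w s ^+ l)^-1.
Proof.
rewrite /= /mxtrace !big_ord_recl big_ord0 !mxE /=.
by case: (e s) => /=; rewrite ?addr0.
Qed.

(** A rotation has two distinct eigenvalues on the two coordinate lines and a
    reflection exchanges the lines, so a nonzero submodule contains both. *)
Lemma rot_repr_irr l (z : F) : z ^+ p = 1 -> z ^+ l.*2 != 1 -> mx_irreducible (rot_repr l).
Proof.
move=> zp z2l; have [r Gr [er wr]] := coord_surj ew false zp.
have [t Gt [et wt]] := coord_surj ew true (expr1n _ p).
have z0 : z ^+ l != 0 by rewrite expf_neq0 // -wr coord_neq0.
have zz : z ^+ l - (z ^+ l)^-1 != 0.
  apply: contra_neq z2l => /eqP; rewrite subr_eq0 => /eqP E.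
  by rewrite -addnn exprD {1}E mulVf.
pose e0 : 'rV[F]_2 := delta_mx 0 0; pose e1 : 'rV[F]_2 := delta_mx 0 1.
rewrite /rot_repr /=; apply/mx_irrP; split=> // U modU nzU.
have actU n (v : 'M[F]_(n, 2)) s : s \in G -> (v <= U)%MS ->
    (v *m rot_mx_representation l s <= U)%MS.
  by move=> Gs vU; exact: mxmodule_trans modU Gs vU.
have e01 : (e0 <= U)%MS = (e1 <= U)%MS.
  have sw (i j : 'I_2) : i != j ->
      (delta_mx 0 i : 'rV[F]_2) *m rot_mx_representation l t = delta_mx 0 j.
    move=> ij; rewrite -rowE; apply/rowP => k; rewrite !mxE et wt expr1n invr1 addbT if_same eqxx /=.
    by rewrite if_neg; move: ij; case: i j k => -[|[|//]] ? [[|[|//]] ?] [[|[|//]] ?].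
  apply/idP/idP => /(actU _ _ t Gt).
    by rewrite (sw 0 1).
  by rewrite (sw 1 0).
suff e0U : (e0 <= U)%MS.
  rewrite -sub1mx; apply/row_subP => i; rewrite row1.
  have [->|i1] := eqVneq i 0; first exact: e0U.
  have -> : i = 1 by apply: val_inj; case: i i1 => -[|[|//]].
  by rewrite -[X in is_true X]e01.
have [v vU v0] : exists2 v : 'rV[F]_2, (v <= U)%MS & v != 0.
  by exists (nz_row U); [exact: nz_row_sub | rewrite nz_row_eq0].
have vE : v = v 0 0 *: e0 + v 0 1 *: e1.
  apply/rowP => k; rewrite !mxE; case: k => -[|[|//]] ?;
  by rewrite /= ?mulr1 ?mulr0 ?addr0 ?add0r; congr (v _ _); apply: val_inj.
(* Subtracting an eigenvalue kills one coordinate of v. *)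
have vr c : v *m (rot_mx_representation l r - c%:M) =
    (z ^+ l - c) * v 0 0 *: e0 + ((z ^+ l)^-1 - c) * v 0 1 *: e1.
  apply/rowP => k; rewrite !mxE !big_ord_recl big_ord0 !mxE er wr.
  case: k => -[|[|//]] ?; rewrite /= ?mulr1 ?mulr0 ?addr0 ?add0r ?mulr0n ?mulr1n
    ?subr0 ?sub0r ?oppr0 ?mulr0 ?addr0 ?add0r.
    by rewrite mulrC.
  by rewrite mulrC; congr (_ * v _ _); apply: val_inj.
have vrU c : (v *m (rot_mx_representation l r - c%:M) <= U)%MS.
  rewrite mulmxBr; apply: addmx_sub; first exact: actU.
  by rewrite eqmx_opp mul_mx_scalar scalemx_sub.
have := vrU ((z ^+ l)^-1); rewrite vr subrr mul0r scale0r addr0.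
have := vrU (z ^+ l); rewrite vr subrr mul0r scale0r add0r.
have zz' : (z ^+ l)^-1 - z ^+ l != 0 by rewrite -opprB oppr_eq0.
have [a0|a0] := eqVneq (v 0 0) 0; last first.
  by move=> _; rewrite (eqmx_scale e0 (mulf_neq0 zz a0)).
have b0 : v 0 1 != 0 by apply: contra_neq v0 => b0; rewrite vE a0 b0 !scale0r addr0.
by rewrite (eqmx_scale e1 (mulf_neq0 zz' b0)) e01.
Qed.

(** Conjugating a reflection by the rotation of coordinate [y] divides its
    coordinate by [y ^+ 2]: two reflections are conjugate when the quotient of
    their coordinates is a square, that is has trivial [q]-th power. *)
Lemma class_refl s t : (forall z : F, exists y, y ^+ 2 = z) ->
  s \in G -> e s -> (t \in (s ^: G)%g) = [&& t \in G, e t & w t ^+ q == w s ^+ q].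
Proof.
move=> sqrtF Gs es; apply/imsetP/and3P => [[x Gx ->]|[Gt et /eqP wt]].
  have Gj : (s ^ x)%g \in G by rewrite groupJ.
  have ej : e (s ^ x)%g.
    have := coord_reflM ew Gx Gj; rewrite conjgE mulKVg (coord_reflM ew) // es.
    by case: (e x); case: (e (x^-1 * (s * x))%g).
  split=> //; have := congr1 (fun y => y ^+ q) (coord_rootM ew Gx Gj).
  rewrite conjgE mulKVg (coord_rootM ew) // es !exprMn -conjgE.
  have -> : (w x)^-1 ^+ q = w x ^+ q by rewrite coord_halfV.
  have -> : (if e x then (w (s ^ x)%g)^-1 else w (s ^ x)%g) ^+ q = w (s ^ x)%g ^+ q.
    by case: (e x) => //; rewrite coord_halfV.
  by rewrite mulrC => /(mulfI (expf_neq0 q (coord_neq0 Gx))) ->.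
have [y y2] := sqrtF (w s / w t).
have yp : y ^+ p = 1.
  rewrite pq -mul2n exprM y2 expr_div_n wt divff //.
  by rewrite expf_neq0 ?coord_neq0.
have [x Gx [ex dhom_x]] := coord_surj ew false yp.
exists x => //; apply: (mulgI x); rewrite conjgE mulKVg.
apply: (coord_inj ew); rewrite ?groupM //.
  by rewrite !(coord_reflM ew) // ex es et.
rewrite !(coord_rootM ew) // ex es dhom_x.
have y0 : y != 0 by rewrite -dhom_x coord_neq0.
apply: (mulfI y0); rewrite mulrA -expr2 y2 divfK ?coord_neq0 //.
by rewrite mulrCA divff // mulr1.
Qed.

(** A rotation is conjugate at most to itself and to its inverse. *)
Lemma class_rot s t : s \in G -> ~~ e s ->
  (t \in (s ^: G)%g) = [&& t \in G, ~~ e t & (w t == w s) || (w t == (w s)^-1)].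
Proof.
move=> Gs /negPf es; apply/imsetP/and3P => [[x Gx ->]|[Gt /negPf et wt]].
  have Gj : (s ^ x)%g \in G by rewrite groupJ.
  have ej : e (s ^ x)%g = false.
    have := coord_reflM ew Gx Gj; rewrite conjgE mulKVg (coord_reflM ew) // es.
    by case: (e x); case: (e (x^-1 * (s * x))%g).
  rewrite ej; split=> //; have := coord_rootM ew Gx Gj.
  rewrite {1}conjgE mulKVg (coord_rootM ew) // es mulrC => /(mulfI (coord_neq0 Gx)) ->.
  by case: (e x); rewrite ?invrK eqxx ?orbT.
case/orP: wt => /eqP wt.
  exists 1%g; rewrite ?group1 // conjg1; apply: (coord_inj ew) => //.
  by rewrite es et.
have [x Gx [ex dhom_x]] := coord_surj ew true (expr1n _ p).
exists x => //; apply: (mulgI x); rewrite conjgE mulKVg.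
apply: (coord_inj ew); rewrite ?groupM //.
  by rewrite !(coord_reflM ew) // ex es et.
by rewrite !(coord_rootM ew) // ex es dhom_x wt invrK mulr1 mul1r.
Qed.

End DihedralCoordinates.

(** * The stabilizer as a group of rotations and reflections *)

Section Dih.
Variable F : fieldType.

(** z |-> w z when b is false, z |-> w / z when b is true. *)
Definition dih (b : bool) (w : F) : option F -> option F :=
  if b then lft 0 w 1 0 else lft w 0 0 1.

Lemma dih_LFT b w : w != 0 -> is_LFT (dih b w).
Proof.
move=> w0; case: b; [exists 0, w, 1, 0|exists w, 0, 0, 1]; split=> //.
  by rewrite mul0r mulr1 sub0r oppr_eq0.
by rewrite mulr1 mulr0 subr0.
Qed.

Lemma lft_scale (k a b c e : F) z : k != 0 ->
  lft (k * a) (k * b) (k * c) (k * e) z = lft a b c e z.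
Proof.
move=> k0; case: z => [x|] /=; last first.
  rewrite mulf_eq0 (negPf k0) /=; case: eqP => // /eqP c0.
  by congr Some; field; rewrite k0 c0.
have -> : k * c * x + k * e = k * (c * x + e) by ring.
rewrite mulf_eq0 (negPf k0) /=; have [//|D0] := eqVneq (c * x + e) 0.
by congr Some; rewrite -mulrA -mulrDr -mulf_div divff // mul1r.
Qed.

Lemma dih_comp b w c y : w != 0 -> y != 0 ->
  dih b w \o dih c y = dih (b (+) c) (w * if b then y^-1 else y).
Proof.
move=> w0 y0; apply/funext => z; rewrite /dih /=; case: b; case: c => /=;
  rewrite lft_comp ?mulr0 ?mul0r ?mulr1 ?mul1r ?subr0 ?sub0r ?oppr_eq0 ?addr0 ?add0r //.
- rewrite -[RHS](lft_scale _ _ _ _ _ y0) ?mulr0 ?mulr1.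
  by congr lft; field.
- rewrite -[RHS](lft_scale _ _ _ _ _ y0) ?mulr0 ?mulr1.
  by congr lft; field.
Qed.

Lemma dih_inj b w c y : w != 0 -> y != 0 -> dih b w = dih c y -> b = c /\ w = y.
Proof.
move=> w0 y0 E; have := congr1 (fun f => f None) E; have := congr1 (fun f => f (Some 1)) E.
rewrite /dih; case: b {E}; case: c; rewrite /= ?eqxx ?oner_eq0 //=;
  by rewrite ?mul0r ?mul1r ?mulr1 ?addr0 ?add0r ?oner_eq0 ?divr1 // => -[->].
Qed.

End Dih.

Section Geometry.
Variables (R : realType) (d : nat) (lam : 'rV[R[i]%C]_d) (Klam : in_K lam).
Local Notation C := R[i]%C.
Local Notation G := (stab_group Klam).
Implicit Types (s t : 'S_(3 + d)).

Lemma in_stab s : (s \in G) = (g_ s^-1%g lam == lam).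
Proof. by rewrite inE. Qed.

Lemma Phi_LFT s : is_LFT (Phi lam s).
Proof. by have [] := f_P s^-1%g Klam. Qed.

Lemma Phi_zpt s i : s \in G -> Phi lam s (zpt lam (s i)) = zpt lam i.
Proof. by rewrite in_stab => /eqP Es; rewrite /Phi -zpt_g // Es. Qed.

Lemma PhiM s t : s \in G -> t \in G -> Phi lam (s * t)%g = Phi lam s \o Phi lam t.
Proof. by move=> _; rewrite in_stab => /eqP Et; rewrite /Phi f_comp // Et. Qed.

Lemma Phi_inj s t : s \in G -> t \in G -> Phi lam s = Phi lam t -> s = t.
Proof.
move=> Gs Gt E; apply/permP => i; apply: (zpt_inj Klam).
by apply: (is_LFT_inj (Phi_LFT s)); rewrite Phi_zpt // E Phi_zpt.
Qed.

(** A linear fractional transformation preserving the points permutes them. *)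
Lemma Phi_surj f : is_LFT f -> (forall i, exists k, f (zpt lam i) = zpt lam k) ->
  exists2 s, s \in G & Phi lam s = f.
Proof.
move=> Lf /choice[h hE].
have h_inj : injective h.
  by move=> i k E; apply: (zpt_inj Klam); apply: (is_LFT_inj Lf); rewrite !hE E.
pose s := (perm h_inj)^-1%g.
have sE i : f (zpt lam (s i)) = zpt lam i.
  by rewrite hE -[in RHS](permKV (perm h_inj) i) permE.
have E : Phi lam s = f.
  apply: sends_base_unique (f_P _ Klam) _; split=> // k.
  by rewrite invgK sE /zpt (unsplitK (inl _ k)).
exists s => //; rewrite in_stab; apply/eqP/rowP => j; rewrite mxE.
by rewrite -/(Phi lam s) E invgK sE /zpt (unsplitK (inr _ j)).
Qed.

Variables (psi : option C -> option C) (p q : nat) (L : seq C) (poles : bool).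
Hypothesis Lpsi : is_LFT psi.
Hypothesis q0 : (0 < q)%N.
Hypothesis pq : p = q.*2.
Hypothesis uL : uniq L.
Hypothesis L0 : forall c, c \in L -> c != 0.
Hypothesis LV : forall c, c \in L -> c^-1 \in L.

(** The common form of the six model sets: [L] lists the p-th powers of the
    points other than 0 and infinity. *)
Definition on_model (z : option C) : bool :=
  if z is Some x then (if x == 0 then poles else x ^+ p \in L) else poles.

Hypothesis modelE : forall z, (exists i, psi (zpt lam i) = z) <-> on_model z.
Hypothesis cardG : #|G| = p.*2.

Let p0 : (0 < p)%N. Proof. by rewrite pq double_gt0. Qed.

Lemma root_neq0 (z : C) : z ^+ p = 1 -> z != 0.
Proof.
move=> E; apply: contra_eq_neq E => ->.
by rewrite expr0n gtn_eqF //= eq_sym oner_eq0.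
Qed.

Lemma on_model_dih b w z : w ^+ p = 1 -> on_model z -> on_model (dih b w z).
Proof.
move=> wp; have w0 := root_neq0 wp.
case: z => [x|] /=; last first.
  by move=> H; rewrite /dih; case: b; rewrite /= ?oner_eq0 /= ?eqxx ?mul0r ?eqxx.
have [->|x0] := eqVneq x 0 => H.
  by rewrite /dih; case: b; rewrite /= ?mulr0 ?add0r ?eqxx ?oner_eq0 /= ?mul0r ?eqxx.
case: b; rewrite /dih /= ?mul1r ?mul0r ?addr0 ?add0r ?(negPf x0) ?oner_eq0 /= ?divr1.
  by rewrite mulf_eq0 invr_eq0 (negPf w0) (negPf x0) /= exprMn wp mul1r exprVn LV.
by rewrite mulf_eq0 (negPf w0) (negPf x0) /= exprMn wp mul1r.
Qed.

Definition has_dih s b w := psi \o Phi lam s = dih b w \o psi.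

Lemma has_dih_inj s t b w : s \in G -> t \in G -> has_dih s b w -> has_dih t b w -> s = t.
Proof.
move=> Gs Gt Es Et; apply: Phi_inj => //; apply/funext => z.
by apply: (is_LFT_inj Lpsi); rewrite -[LHS]/((psi \o _) z) Es -Et.
Qed.

Lemma has_dih_fun s b w c y : w != 0 -> y != 0 -> has_dih s b w -> has_dih s c y ->
  b = c /\ w = y.
Proof.
move=> w0 y0 Es Et; apply: dih_inj => //; have [h [_ _ hK]] := is_LFT_inv Lpsi.
apply/funext => z; rewrite -[z]hK.
by rewrite -[LHS]/((dih b w \o psi) _) -Es Et.
Qed.

Lemma has_dih_ex b w : w ^+ p = 1 -> exists2 s, s \in G & has_dih s b w.
Proof.
move=> wp; have [h [Lh psiK hK]] := is_LFT_inv Lpsi.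
have [|i|s Gs E] := @Phi_surj (h \o (dih b w \o psi)).
- exact: is_LFT_comp Lh (is_LFT_comp (dih_LFT b (root_neq0 wp)) Lpsi).
- have Z : on_model (dih b w (psi (zpt lam i))).
    by apply: on_model_dih => //; apply/modelE; exists i.
  by have [k E] := iffRL (modelE _) Z; exists k; rewrite /= -E psiK.
by exists s => //; rewrite /has_dih E; apply/funext => z /=; rewrite hK.
Qed.

(** The elements given by [has_dih_ex] are distinct and as many as the order of
    the stabilizer. *)
Lemma has_dih_all s : s \in G -> exists b w, w ^+ p = 1 /\ has_dih s b w.
Proof.
have zp (k : 'I_p) : (zeta R p ^+ k) ^+ p = 1.
  by rewrite exprAC (prim_expr_order (zeta_prim R p0)) expr1n.
have /choice[h hE] (bk : bool * 'I_p) :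
    exists s, s \in G /\ has_dih s bk.1 (zeta R p ^+ bk.2).
  by have [u Gu E] := has_dih_ex bk.1 (zp bk.2); exists u.
have h_inj : injective h.
  move=> [b k] [c l] E; have [_ E1] := hE (b, k); have [_ E2] := hE (c, l).
  rewrite -E in E2; have [/= -> /eqP] := has_dih_fun (root_neq0 (zp _)) (root_neq0 (zp _)) E1 E2.
  rewrite (eq_prim_root_expr (zeta_prim R p0)) !modn_small ?ltn_ord // => /eqP kl.
  by congr (_, _); apply: val_inj.
have im : h @: [set: bool * 'I_p] = G.
  apply/eqP; rewrite eqEcard; apply/andP; split.
    by apply/fintype.subsetP => _ /imsetP[bk _ ->]; have [] := hE bk.
  by rewrite card_imset // cardsT card_prod card_bool card_ord cardG mul2n.
rewrite -im => /imsetP[bk _ ->]; have [_ E] := hE bk.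
by exists bk.1, (zeta R p ^+ bk.2); split; first exact: zp.
Qed.

Lemma exists_dihedral_coords : exists e w, dihedral_coords G p e w /\
  forall s, s \in G -> has_dih s (e s) (w s).
Proof.
have /choice[ew ewE] (s : 'S_(3 + d)) : exists bw : bool * C, s \in G ->
    bw.2 ^+ p = 1 /\ has_dih s bw.1 bw.2.
  have [/has_dih_all[b [w H]]|_] := boolP (s \in G); first by exists (b, w).
  by exists (false, 1).
pose e s := (ew s).1; pose w s := (ew s).2.
have wp s : s \in G -> w s ^+ p = 1 by case/ewE.
have w0 s : s \in G -> w s != 0 by move=> /wp /root_neq0.
have E s : s \in G -> has_dih s (e s) (w s) by case/ewE.
have M s t : s \in G -> t \in G -> e (s * t)%g = e s (+) e t /\
    w (s * t)%g = w s * (if e s then (w t)^-1 else w t).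
  move=> Gs Gt; apply: (has_dih_fun (s := (s * t)%g)); rewrite ?w0 ?groupM //.
  - by rewrite mulf_neq0 ?w0 //; case: (e s); rewrite ?invr_eq0 w0.
  - by apply: E; rewrite groupM.
  rewrite /has_dih PhiM // compA (E s Gs) -compA (E t Gt) compA.
  by rewrite dih_comp ?w0.
exists e, w; split=> //; split=> // [s t Gs Gt|s t Gs Gt|s t Gs Gt es ws|b z zp].
- by case: (M s t Gs Gt).
- by case: (M s t Gs Gt).
- by apply: (has_dih_inj Gs Gt (E s Gs)); rewrite es ws; apply: E.
have [s Gs Es] := has_dih_ex b zp; exists s => //.
by apply: (has_dih_fun _ _ (E s Gs) Es); rewrite ?w0 ?root_neq0.
Qed.

(** * Fixed points and traces *)

Lemma card_points : (3 + d)%N = (p * size L + poles.*2)%N.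
Proof.
pose ms : seq (option C) := (if poles then [:: Some 0; None] else [::]) ++
  [seq Some x | x <- flatten [seq root_seq p c | c <- L]].
have mem_roots x : (x \in flatten [seq root_seq p c | c <- L]) = (x ^+ p \in L).
  apply/flatten_mapP/idP => [[c cL]|xL]; first by rewrite root_seqP ?L0 // => /eqP ->.
  by exists (x ^+ p); rewrite ?root_seqP ?L0 ?eqxx.
have nz x : x ^+ p \in L -> x != 0.
  by apply: contraTneq => ->; apply/negP => /L0; rewrite expr0n gtn_eqF // eqxx.
have msE z : (z \in ms) = on_model z.
  rewrite mem_cat; case: z => [x|] /=; last first.
    by rewrite [X in _ || X](_ : _ = false) ?orbF; [case: poles | apply/mapP => -[]].
  rewrite (mem_map (@Some_inj _)) mem_roots; case: eqP => [->|/eqP x0].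
    rewrite [X in _ || X](_ : _ = false) ?orbF; last by apply/negP => /nz; rewrite eqxx.
    by case: poles; rewrite ?inE ?eqxx.
  by case: poles => //=; rewrite !inE /= orbF (inj_eq (@Some_inj _)) (negPf x0).
have ums : uniq ms.
  rewrite cat_uniq (map_inj_uniq (@Some_inj _)); apply/and3P; split.
  - by case: poles.
  - apply/hasPn => z /mapP[x]; rewrite mem_roots => /nz x0 ->.
    by case: poles; rewrite //= !inE /= orbF (inj_eq (@Some_inj _)).
  elim: (L) uL L0 => //= c l IH /andP[cl ul] l0; rewrite cat_uniq.
  rewrite root_seq_uniq ?l0 ?mem_head //= IH //; last by move=> c' H; rewrite l0 // inE H orbT.
  rewrite andbT; apply/hasPn => x /flatten_mapP[c' c'l].
  rewrite !root_seqP ?l0 ?mem_head // ?inE ?c'l ?orbT // => /eqP ->.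
  by apply: contraNneq cl => <-.
have sz : size ms = (p * size L + poles.*2)%N.
  rewrite size_cat size_map size_flatten /shape -map_comp addnC; congr (_ + _)%N.
    rewrite (eq_map (g := fun=> p)); last by move=> c /=; rewrite size_root_seq.
    by elim: (L) => [|c l IH] /=; rewrite ?muln0 // IH mulnS.
  by case: poles.
rewrite -sz -[LHS](card_ord (3 + d)) cardE -(size_map (psi \o zpt lam)).
apply/perm_size/uniq_perm => //.
  rewrite map_inj_uniq ?enum_uniq //.
  by apply: inj_comp; [exact: is_LFT_inj | exact: zpt_inj].
move=> z; rewrite msE; apply/mapP/idP => [[i _ ->]|/modelE[i <-]].
  by apply/modelE; exists i.
by exists i; rewrite ?mem_enum.
Qed.

Lemma psi_zpt_inj : injective (psi \o zpt lam).
Proof. by apply: inj_comp; [exact: is_LFT_inj | exact: zpt_inj]. Qed.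

Lemma fixedE s i : s \in G -> (s i == i) = (Phi lam s (zpt lam i) == zpt lam i).
Proof.
move=> Gs; apply/eqP/eqP => [E|E]; first by rewrite -{1}E Phi_zpt.
apply: (zpt_inj Klam); apply: (is_LFT_inj (Phi_LFT s)).
by rewrite Phi_zpt.
Qed.

Lemma fixed_dih s b w i : s \in G -> has_dih s b w ->
  (s i == i) = (dih b w (psi (zpt lam i)) == psi (zpt lam i)).
Proof.
move=> Gs E; rewrite fixedE // -[dih b w _]/((dih b w \o psi) _) -E /=.
by rewrite (inj_eq (is_LFT_inj Lpsi)).
Qed.

(** The map z |-> w / z fixes the two square roots of w, and their common p-th
    power is w ^+ q because p is even. *)
Lemma card_fixed_refl s w : s \in G -> w ^+ p = 1 -> has_dih s true w ->
  #|[pred i | s i == i]| = (w ^+ q \in L).*2.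
Proof.
move=> Gs wp E; have w0 := root_neq0 wp.
pose y := sqrtC w; have y2 : y ^+ 2 = w by rewrite sqrtCK.
have y0 : y != 0 by rewrite sqrtC_eq0.
have yp : y ^+ p = w ^+ q by rewrite pq -mul2n exprM y2.
have yNp : (- y) ^+ p = w ^+ q by rewrite pq -mul2n exprM sqrrN y2.
have yN : y != - y by rewrite -subr_eq0 opprK -mulr2n mulrn_eq0.
have fixE i : (s i == i) = (psi (zpt lam i) == Some y) || (psi (zpt lam i) == Some (- y)).
  rewrite (fixed_dih _ Gs E); case: (psi _) => [x|] //=; last by rewrite oner_eq0 mul0r.
  rewrite /dih /= mul1r mul0r addr0 add0r !(inj_eq (@Some_inj _)).
  have [->|x0] := eqVneq x 0; first by rewrite ![0 == _]eq_sym oppr_eq0 (negPf y0).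
  by rewrite (inj_eq (@Some_inj _)) -(inj_eq (mulIf x0)) divfK // -expr2 -y2 eq_sym eqf_sqr.
have [wL|wL] := boolP (w ^+ q \in L); last first.
  apply/eqP/eqP/eq_card0 => i; rewrite inE fixE; apply/negP => H; case/negP: wL.
  have : on_model (psi (zpt lam i)) by apply/modelE; exists i.
  by case/orP: H => /eqP -> /=; rewrite ?oppr_eq0 (negPf y0) ?yp ?yNp.
have [i0 E0] : exists i, psi (zpt lam i) = Some y by apply/modelE; rewrite /= (negPf y0) yp.
have [i1 E1] : exists i, psi (zpt lam i) = Some (- y).
  by apply/modelE; rewrite /= oppr_eq0 (negPf y0) yNp.
have i01 : i0 != i1 by apply: contra_neq yN => H; move: E0; rewrite H E1 => -[].
have -> : (true.*2 = #|pred2 i0 i1|)%N by rewrite card2 i01.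
apply: eq_card => i.
by rewrite !inE fixE -E0 -E1 !(inj_eq psi_zpt_inj).
Qed.

Lemma nb_fixed_refl s w : s \in G -> w ^+ p = 1 -> has_dih s true w ->
  nb_fixed lam s = (w ^+ q \in L).*2.
Proof.
move=> Gs wp E; rewrite -(card_fixed_refl Gs wp E); apply: eq_card => i.
by rewrite !inE fixedE.
Qed.

(** [mxtrace_jac] for the matrix of the inverse transformation.  A reflection has
    trace zero and multiplier -1 at its fixed points; a rotation by w has
    multipliers w and 1 / w at the poles, and no other fixed point. *)
Lemma mxtrace_jac_dih s b w : s \in G -> w ^+ p = 1 -> has_dih s b w ->
  (b || (w != 1)) ->
  \tr (jac lam s) = if b then 1 - (w ^+ q \in L).*2%:R
                    else -1 - (if poles then 0 else w + w^-1).
Proof.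
move=> Gs wp E bw; have w0 := root_neq0 wp.
have [a [be [c [de [D0 psiE]]]]] := Lpsi.
pose D := a * de - be * c; rewrite -/D in D0.
(* With P the matrix of psi, [X] and [Y] are the rows of P, [X'] and [Y'] those
   of the matrix of dih^-1 times P, and [n11] to [n22] the entries of its product
   by the adjugate of P, which is a matrix of the inverse of [Phi lam s]. *)
pose X x y := a * x + be * y; pose Y x y := c * x + de * y.
pose X' x y := if b then w * Y x y else X x y.
pose Y' x y := if b then X x y else w * Y x y.
pose n11 := de * X' 1 0 - be * Y' 1 0; pose n12 := de * X' 0 1 - be * Y' 0 1.
pose n21 := a * Y' 1 0 - c * X' 1 0; pose n22 := a * Y' 0 1 - c * X' 0 1.
have detN : n11 * n22 - n12 * n21 = D ^+ 2 * (if b then - w else w).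
  by rewrite /n11 /n12 /n21 /n22 /X' /Y' /X /Y /D; case: (b); ring.
have trN : n11 + n22 = if b then 0 else D * (1 + w).
  by rewrite /n11 /n12 /n21 /n22 /X' /Y' /X /Y /D; case: (b); ring.
have detN0 : n11 * n22 - n12 * n21 != 0.
  by rewrite detN mulf_neq0 ?expf_neq0 //; case: (b); rewrite ?oppr_eq0.
have XN x y : X (n11 * x + n12 * y) (n21 * x + n22 * y) = D * X' x y.
  by rewrite /n11 /n12 /n21 /n22 /X' /Y' /X /Y /D; case: (b); ring.
have YN x y : Y (n11 * x + n12 * y) (n21 * x + n22 * y) = D * Y' x y.
  by rewrite /n11 /n12 /n21 /n22 /X' /Y' /X /Y /D; case: (b); ring.
have nzN (a1 b1 c1 d1 x y : C) : a1 * d1 - b1 * c1 != 0 -> (x != 0) || (y != 0) ->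
    (a1 * x + b1 * y != 0) || (c1 * x + d1 * y != 0).
  move=> Dn; apply: contraTT; rewrite !negb_or !negbK => /andP[/eqP H1 /eqP H2].
  have Ex : (a1 * d1 - b1 * c1) * x = d1 * (a1 * x + b1 * y) - b1 * (c1 * x + d1 * y) by ring.
  have Ey : (a1 * d1 - b1 * c1) * y = a1 * (c1 * x + d1 * y) - c1 * (a1 * x + b1 * y) by ring.
  move/eqP: Ex; rewrite H1 H2 !mulr0 subrr mulf_eq0 (negPf Dn) /= => ->.
  by move/eqP: Ey; rewrite H1 H2 !mulr0 subrr mulf_eq0 (negPf Dn) /= => ->.
have psi_pt x y : (x != 0) || (y != 0) -> psi (proj_pt x y) = proj_pt (X x y) (Y x y).
  by move=> xy; rewrite psiE lft_proj_pt.
have N_zpt i : lft n11 n12 n21 n22 (zpt lam i) = zpt lam (s i).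
  apply: (is_LFT_inj Lpsi); apply: (is_LFT_inj (dih_LFT b w0)).
  have := congr1 (fun f => f (zpt lam (s i))) E; rewrite /= Phi_zpt // => <-.
  rewrite !zpt_proj lft_proj_pt ?hom_neq0 // psi_pt ?nzN ?hom_neq0 // XN YN psi_pt ?hom_neq0 //.
  set x := hom_x _ _; set y := hom_y _ _.
  have nz' : (X x y != 0) || (Y x y != 0) by apply: nzN => //; apply: hom_neq0.
  have nz1 : (D * X' x y != 0) || (D * Y' x y != 0).
    by rewrite !mulf_eq0 (negPf D0) /X' /Y'; case: (b); rewrite /= mulf_eq0 (negPf w0) //= orbC.
  rewrite /dih /X' /Y' in nz1 *; case: (b) nz1 => nz1; rewrite lft_proj_pt //;
    rewrite !mul0r mul1r addr0 add0r; apply/eqP; rewrite proj_pt_eq //.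
  - by apply/eqP; ring.
  - by rewrite !mulf_eq0 (negPf D0) (negPf w0).
  - by apply/eqP; ring.
  - by rewrite !mulf_eq0 (negPf D0) (negPf w0).
have /choice[k kE] (i : 'I_(3 + d)) : exists k, k != 0 /\
    (hom_x lam (s i) = k * (n11 * hom_x lam i + n12 * hom_y C i) /\
     hom_y C (s i) = k * (n21 * hom_x lam i + n22 * hom_y C i)).
  have := N_zpt i; rewrite !zpt_proj lft_proj_pt ?hom_neq0 //.
  by case/(proj_pt_scale (nzN _ _ _ _ _ _ detN0 (hom_neq0 lam i)) (hom_neq0 _ _)) => k k0 H; exists k.
rewrite (mxtrace_jac Klam detN0 (fun i => proj1 (kE i)) (fun i => proj2 (kE i))).
rewrite detN trN.
have XZ l x y : X (l * x) (l * y) = l * X x y by rewrite /X; ring.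
have YZ l x y : Y (l * x) (l * y) = l * Y x y by rewrite /Y; ring.
have eigX i : s i = i -> X (hom_x lam i) (hom_y C i) = k i * (D * X' (hom_x lam i) (hom_y C i)).
  by move=> si; have [_ [kx ky]] := kE i; rewrite si in kx ky; rewrite -XN -XZ -kx -ky.
have eigY i : s i = i -> Y (hom_x lam i) (hom_y C i) = k i * (D * Y' (hom_x lam i) (hom_y C i)).
  by move=> si; have [_ [kx ky]] := kE i; rewrite si in kx ky; rewrite -YN -YZ -kx -ky.
have XYnz i : (X (hom_x lam i) (hom_y C i) != 0) || (Y (hom_x lam i) (hom_y C i) != 0).
  by apply: nzN => //; apply: hom_neq0.
have psi_i i :
    psi (zpt lam i) = proj_pt (X (hom_x lam i) (hom_y C i)) (Y (hom_x lam i) (hom_y C i)).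
  by rewrite zpt_proj psi_pt ?hom_neq0.
case: b => /= in E bw X' Y' n11 n12 n21 n22 detN trN detN0 XN YN N_zpt kE eigX eigY *.
  rewrite expr0n mul0r subr0 addrC; congr (_ + _).
  transitivity (\sum_(i | s i == i) (-1 : C)).
    apply: eq_bigr => i /eqP si; have [k0 _] := kE i.
    have kk : k i ^+ 2 * (D ^+ 2 * w) = 1.
      have Ex := eigX i si; have Ey := eigY i si; rewrite /X' /Y' in Ex Ey.
      case/orP: (XYnz i) => H; apply: (mulIf H); rewrite mul1r.
        by rewrite [RHS]Ex Ey; ring.
      by rewrite [RHS]Ey Ex; ring.
    rewrite mulrN mulNr invrN; congr (- _).
    by rewrite [_ * w]mulrC [X in X^-1]mulrC -[w * _]mulrC kk invr1.
  by rewrite sumr_const (card_fixed_refl Gs wp E) mulNrn.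
have -> : (D * (1 + w)) ^+ 2 / (D ^+ 2 * w) = w + w^-1 + 2.
  by field; rewrite w0 D0.
suff -> : \sum_(i | s i == i) (D ^+ 2 * w * k i ^+ 2)^-1 = if poles then w + w^-1 else 0.
  by case: (poles); ring.
have fixE i : (s i == i) = (psi (zpt lam i) == Some 0) || (psi (zpt lam i) == None).
  rewrite (fixed_dih _ Gs E); case: (psi _) => [x|] //=; last by rewrite eqxx.
  rewrite mul0r add0r oner_eq0 divr1 addr0 orbF !(inj_eq (@Some_inj _)).
  by rewrite -subr_eq0 -{2}[x]mul1r -mulrBl mulf_eq0 subr_eq0 (negPf bw).
case Ep: poles; last first.
  rewrite big1 // => i; rewrite fixE => H; exfalso.
  have : on_model (psi (zpt lam i)) by apply/modelE; exists i.
  by case/orP: H => /eqP -> /=; rewrite ?eqxx Ep.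
have [i0 E0] : exists i, psi (zpt lam i) = Some 0 by apply/modelE; rewrite /= eqxx Ep.
have [i1 E1] : exists i, psi (zpt lam i) = None by apply/modelE; rewrite /= Ep.
have i01 : i1 != i0 by apply/eqP => H; move: E0; rewrite -H E1.
rewrite (bigD1 i0) ?fixE ?E0 ?eqxx //= (bigD1 i1) ?fixE ?E1 ?eqxx //= big1 ?addr0; last first.
  move=> i /andP[/andP[]]; rewrite fixE -E0 -E1 !(inj_eq psi_zpt_inj).
  by move=> /orP[] /eqP ->; rewrite ?eqxx ?andbF.
congr (_ + _).
  have si : s i0 = i0 by apply/eqP; rewrite fixE E0 eqxx.
  have Y0 : Y (hom_x lam i0) (hom_y C i0) != 0 by move: E0; rewrite psi_i /proj_pt; case: eqP.
  have YE := eigY i0 si; rewrite /Y' in YE; have [k0 _] := kE i0.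
  have kk : k i0 * D * w = 1 by apply: (mulIf Y0); rewrite mul1r [RHS]YE; ring.
  have -> : D ^+ 2 * w * k i0 ^+ 2 = (k i0 * D * w) ^+ 2 / w by field.
  by rewrite kk expr1n mul1r invrK.
have si : s i1 = i1 by apply/eqP; rewrite fixE E1 eqxx orbT.
have Y0 : Y (hom_x lam i1) (hom_y C i1) = 0 by move: E1; rewrite psi_i /proj_pt; case: eqP.
have X0 := XYnz i1; rewrite Y0 eqxx orbF in X0.
have XE := eigX i1 si; rewrite /X' in XE; have [k0 _] := kE i1.
have kk : k i1 * D = 1 by apply: (mulIf X0); rewrite mul1r [RHS]XE; ring.
have -> : D ^+ 2 * w * k i1 ^+ 2 = (k i1 * D) ^+ 2 * w by ring.
by rewrite kk expr1n mul1r.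
Qed.

End Geometry.

(** * The six model sets *)

(** Whether the configurations of a type contain A_p, B_p and the two poles. *)
Definition type_A (T : config_type) :=
  match T with T_AC | T_ABC | T_A2C | T_AB2C => true | _ => false end.
Definition type_B (T : config_type) :=
  match T with T_ABC | T_AB2C => true | _ => false end.
Definition type_poles (T : config_type) :=
  match T with T_2C | T_A2C | T_AB2C => true | _ => false end.

Section Model.
Variables (R : realType) (d : nat) (lam : 'rV[R[i]%C]_d).
Local Notation C := R[i]%C.
Variables (psi : option C -> option C) (T : config_type) (p m : nat).

Record model_data (L : seq C) : Prop := ModelData {
  md_uniq : uniq L;
  md_neq0 : forall c, c \in L -> c != 0;
  md_inv : forall c, c \in L -> c^-1 \in L;
  md_size : size L = (type_A T + type_B T + m.*2)%N;
  md_A : (1 \in L) = type_A T;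
  md_B : (-1 \in L) = type_B T;
  md_model : forall z, (exists i, psi (zpt lam i) = z) <-> on_model p L (type_poles T) z }.

Lemma mem_model (D : set C) z : (0 < p)%N ->
  model T p D z <-> if z is Some x
    then type_poles T /\ x = 0 \/ type_A T /\ x ^+ p = 1 \/ type_B T /\ x ^+ p = -1 \/ D x
    else type_poles T.
Proof.
move=> p0.
have finS (E : set C) x : [set Some w | w in E]%classic (Some x) = E x.
  by apply/propext; split=> [[w Ew [<-]]|Ex] //; exists x.
have finN (E : set C) : [set Some w | w in E]%classic None = False.
  by apply/propext; split=> // -[].
have sS x y : [set y]%classic (Some x : option C) = (Some x = y) by [].
have sN y : [set y]%classic (None : option C) = (None = y) by [].
have S0 x : (Some x = Some (0 : C)) = (x = 0).
  by apply/propext; split=> [[->]|->].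
have SN x : (Some x = None :> option C) = False by apply/propext.
have N0 : (None = Some (0 : C)) = False by apply/propext.
have NN : (None = None :> option C) = True by apply/propext.
have AE x : A_ p x = (x ^+ p = 1) by apply/propext/mem_A.
have BE x : B_ p x = (x ^+ p = -1) by apply/propext/mem_B.
have U (E E' : set (option C)) y : (E `|` E')%classic y = (E y \/ E' y) by [].
have U' (E E' : set C) y : (E `|` E')%classic y = (E y \/ E' y) by [].
have F : is_true false = False by apply/propext.
have Tr : is_true true = True by apply/propext.
by case: z => [x|]; case: T; cbv beta iota zeta delta [model type_A type_B type_poles];
  rewrite ?U ?finS ?finN ?sS ?sN ?S0 ?SN ?N0 ?NN ?U' ?AE ?BE ?F ?Tr; tauto.
Qed.

(** The list L consists of 1 for A_p, of -1 for B_p, and of c and 1 / c for each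
    C_p(a), where c = a ^+ p.  Admissibility of a says that c is not 1 or -1,
    so c and 1 / c are distinct, and distinct orbits give distinct pairs. *)
Lemma has_type_data : (0 < p)%N -> has_type lam psi T p m -> exists L, model_data L.
Proof.
move=> p0 [Lpsi [_ [a [adm inj im]]]].
have {}adm i := iffLR (C_admissibleE (a i) p0) (adm i).
pose c i := a i ^+ p.
have c0 i : c i != 0 by rewrite expf_neq0 //; case: (adm i).
have c2 i : c i ^+ 2 != 1 by case: (adm i).
have cI i j : c i = c j \/ c i = (c j)^-1 -> i = j.
  move=> cij; apply: inj; apply/seteqP; split=> x; rewrite !mem_C ?(adm _).1 // -/(c i) -/(c j).
    by case: cij => ->; rewrite ?invrK; tauto.
  by case: cij => ->; rewrite ?invrK; tauto.
have c1 i : c i != 1 by apply: contra_neq (c2 i) => ->; rewrite expr1n.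
have cN1 i : c i != -1 by apply: contra_neq (c2 i) => ->; rewrite sqrrN expr1n.
have cV i : (c i)^-1 != c i.
  by apply: contra_neq (c2 i) => E; rewrite expr2 -{1}E mulVf.
pose f (ib : 'I_m * bool) := if ib.2 then (c ib.1)^-1 else c ib.1.
have f_inj : injective f.
  move=> [i b] [j b']; rewrite /f /= => E; have ij : i = j.
    apply: cI; case: b b' E => -[] E; [left|right|right|left] => //.
      exact: invr_inj. by rewrite -E invrK.
  rewrite -ij in E *; congr (_, _); case: b b' E => -[] //= /eqP; rewrite ?(negPf (cV i)) //.
  by rewrite eq_sym (negPf (cV i)).
have f_neq (x : C) ib : x != 0 -> x^-1 = x -> (forall i, c i != x) -> f ib != x.
  move=> x0 xV cx; rewrite /f; case: ib.2 => //; rewrite -{1}xV (inj_eq invr_inj) //.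
pose Lf := [seq f ib | ib <- enum {: 'I_m * bool}].
have LfP x : (x \in Lf) <-> exists i, x = c i \/ x = (c i)^-1.
  split=> [/mapP[[i b] _ ->]|[i H]].
    by exists i; rewrite /f; case: b; [right|left].
  case: H => ->; apply/mapP; [exists (i, false)|exists (i, true)] => //; exact: mem_enum.
have oneN : (1 : C) != -1 by rewrite -subr_eq0 opprK -mulr2n mulrn_eq0 oner_eq0.
have N1Lf (x : C) : x != 0 -> x^-1 = x -> (forall i, c i != x) -> x \notin Lf.
  by move=> x0 xV cx; apply/negP => /mapP[ib _ E]; have := f_neq x ib x0 xV cx; rewrite -E eqxx.
have h1 : 1 \notin Lf by apply: N1Lf; rewrite ?oner_eq0 ?invr1.
have hN1 : -1 \notin Lf by apply: N1Lf; rewrite ?oppr_eq0 ?oner_eq0 ?invrN1.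
pose LA : seq C := nseq (type_A T) 1; pose LB : seq C := nseq (type_B T) (-1).
have memL x : (x \in LA ++ LB ++ Lf) =
    [|| type_A T && (x == 1), type_B T && (x == -1) | x \in Lf].
  by rewrite !mem_cat /LA /LB; case: type_A; case: type_B; rewrite !inE.
have L0 x : x \in LA ++ LB ++ Lf -> x != 0.
  rewrite memL => /or3P[/andP[_ /eqP ->]|/andP[_ /eqP ->]|/LfP[i [->|->]]];
    by rewrite ?invr_eq0 ?oppr_eq0 ?oner_eq0.
exists (LA ++ LB ++ Lf); split=> //.
- rewrite !cat_uniq map_inj_uniq // enum_uniq andbT.
  have -> : uniq LA by rewrite /LA; case: type_A.
  have -> : uniq LB by rewrite /LB; case: type_B.
  rewrite /= has_cat negb_or -andbA; apply/and3P; split; apply/hasPn => x.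
  + rewrite /LA /LB; case: type_A; case: type_B => //; rewrite !inE => /eqP ->.
    by rewrite eq_sym.
  + move=> xL; rewrite /LA; case: type_A; rewrite //= inE.
    by apply: contraNneq h1 => <-.
  + move=> xL; rewrite /LB; case: type_B; rewrite //= inE.
    by apply: contraNneq hN1 => <-.
- move=> x; rewrite !memL => /or3P[/andP[-> /eqP ->]|/andP[-> /eqP ->]|/LfP[i H]].
  + by rewrite invr1 eqxx.
  + by rewrite invrN1 eqxx orbT.
  apply/or3P/Or33/LfP; exists i; case: H => ->; first by right.
  by rewrite invrK; left.
- rewrite !size_cat !size_nseq size_map -cardE card_prod card_ord card_bool muln2.
  by rewrite addnA.
- by rewrite memL eqxx (negPf oneN) (negPf h1) andbF !orbF andbT.
- by rewrite memL eqxx eq_sym (negPf oneN) (negPf hN1) andbF andbT !orbF.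
move=> z; have -> : (exists i, psi (zpt lam i) = z) <-> (psi @` points lam)%classic z.
  split=> [[i <-]|[y [i _ <-] <-]]; last by exists i.
  by exists (zpt lam i) => //; exists i.
rewrite im mem_model //; case: z => [x|] //=.
have DE : (\bigcup_(i in [set: 'I_m]) C_ p (a i))%classic x <-> x ^+ p \in Lf.
  rewrite LfP; split=> [[i _ /mem_C H]|[i H]].
    by exists i; apply: H => //; case: (adm i).
  by exists i => //; apply/mem_C => //; case: (adm i).
have [->|x0] := eqVneq x 0.
  split=> [[[]|[[_]|[[_]|]]]//|P]; last by left.
  - by move=> /esym/eqP; rewrite expr0n gtn_eqF // oner_eq0.
  - by move=> /esym/eqP; rewrite expr0n gtn_eqF // oppr_eq0 oner_eq0.
  case=> i _ /mem_C; rewrite expr0n gtn_eqF // => H.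
  have [ai0 _] := adm i.
  by case: (H p0 ai0) => /esym /eqP; rewrite -/(c i) ?invr_eq0 (negPf (c0 i)).
rewrite memL; split=> [[[_ /eqP]|[[-> ->]|[[-> ->]|/DE ->]]]|/or3P[/andP[-> /eqP ->]|/andP[-> /eqP ->]|/DE H]].
- by rewrite (negPf x0).
- by rewrite eqxx.
- by rewrite eqxx orbT.
- by rewrite !orbT.
- by right; left.
- by right; right; left.
by right; right; right.
Qed.

End Model.

(** * Sums and powers of roots of unity *)

Lemma mulr_geom_sum (F : fieldType) (w : F) n : (0 < n)%N ->
  (w - 1) * \sum_(1 <= j < n) w ^+ j = w ^+ n - w.
Proof.
elim: n => // n IH _; case: n IH => [|n] IH; first by rewrite big_geq // mulr0 expr1 subrr.
by rewrite big_nat_recr //= mulrDr IH // ![w ^+ n.+2]exprS; ring.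
Qed.

(** The terms are all the powers of w other than 1 and w ^+ q, once each, and the
    sum of all the powers is zero. *)
Lemma sum_cos (F : fieldType) (w : F) q : (0 < q)%N -> w ^+ q.*2 = 1 -> w != 1 ->
  \sum_(1 <= j < q) (w ^+ j + (w ^+ j)^-1) = -1 - w ^+ q.
Proof.
move=> q0 wp w1.
have w0 : w != 0.
  by apply: contra_eq_neq wp => ->; rewrite expr0n gtn_eqF ?double_gt0 // eq_sym oner_eq0.
have wq : (w ^+ q)^-1 = w ^+ q.
  by apply: (mulfI (expf_neq0 q w0)); rewrite divff ?expf_neq0 // -exprD addnn.
have w1' : w - 1 != 0 by rewrite subr_eq0.
have wV1 : w^-1 - 1 != 0 by rewrite subr_eq0 invr_eq1.
rewrite big_split /=.
have -> : \sum_(1 <= j < q) w ^+ j = (w ^+ q - w) / (w - 1).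
  by rewrite -mulr_geom_sum // mulrC mulKf.
have -> : \sum_(1 <= j < q) (w ^+ j)^-1 = (w ^+ q - w^-1) / (w^-1 - 1).
  by rewrite -{1}wq -exprVn -mulr_geom_sum // mulrC mulKf //; apply: eq_bigr => j _; rewrite exprVn.
by field; rewrite w0 w1' mulN1r subr_eq0 eq_sym w1.
Qed.

Section Zeta.
Variables (R : realType) (p q : nat).
Local Notation C := R[i]%C.
Hypotheses (q0 : (0 < q)%N) (pq : p = q.*2).
Let p0 : (0 < p)%N. Proof. by rewrite pq double_gt0. Qed.
Let zprim := zeta_prim R p0.

Lemma zeta_half : zeta R p ^+ q = -1.
Proof.
have /eqP : (zeta R p ^+ q) ^+ 2 = 1 by rewrite -exprM muln2 -pq (prim_expr_order zprim).
rewrite sqrf_eq1 => /orP[|/eqP //].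
rewrite -(prim_order_dvd zprim) => /dvdn_leq; rewrite pq => /(_ q0).
by rewrite -addnn -{3}[q]addn0 leq_add2l leqNgt q0.
Qed.

Lemma zeta_neq0 : zeta R p != 0.
Proof. exact: cis_neq0. Qed.

Lemma cis_sign_zeta (e : bool) l :
  cis ((-1) ^+ e * (2 * pi * l%:R / p%:R) : R) = if e then (zeta R p ^+ l)^-1 else zeta R p ^+ l.
Proof.
have -> : 2 * pi * l%:R / p%:R = l%:R * (2 * pi / p%:R) :> R.
  by ring.
by case: e; rewrite ?expr1 ?expr0 ?mulN1r ?mul1r ?cisN cis_natmul.
Qed.

(** The rotations by [zeta ^+ i], for i at most half of p, are pairwise distinct
    even up to inversion. *)
Lemma zeta_eqX i j : (1 <= i <= q)%N -> (1 <= j <= q)%N ->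
  zeta R p ^+ i = zeta R p ^+ j \/ zeta R p ^+ i = (zeta R p ^+ j)^-1 -> i = j.
Proof.
move=> /andP[i1 iq] /andP[j1 jq] [/eqP|/eqP].
  by rewrite (eq_prim_root_expr zprim) !modn_small; [move/eqP| lia | lia].
rewrite -(inj_eq (mulIf (expf_neq0 j zeta_neq0))) mulVf ?expf_neq0 ?zeta_neq0 // -exprD.
rewrite -(prim_order_dvd zprim) => /dvdnP[[|k]]; lia.
Qed.

Lemma root_zeta w : w ^+ p = 1 -> w != 1 -> exists2 l, (1 <= l <= q)%N &
  w = zeta R p ^+ l \/ w = (zeta R p ^+ l)^-1.
Proof.
move=> /(prim_rootP zprim)[[k kp] /= ->] w1.
have k0 : (0 < k)%N by rewrite lt0n; apply: contra_neq w1 => ->; rewrite expr0.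
have [kq|qk] := leqP k q; first by exists k; [rewrite k0 kq | left].
exists (p - k)%N; first by rewrite pq in kp *; lia.
right; apply: (mulIf (expf_neq0 (p - k) zeta_neq0)).
by rewrite mulVf ?expf_neq0 ?zeta_neq0 // -exprD subnKC ?(prim_expr_order zprim) // ltnW.
Qed.

End Zeta.

(** * The irreducible representations *)

Section Irr.
Variables (F : fieldType) (gT : finGroupType) (G : {group gT}) (p q : nat).
Variables (e : gT -> bool) (w : gT -> F).
Hypothesis (ew : dihedral_coords G p e w) (q0 : (0 < q)%N) (pq : p = q.*2).
Variables (eps : F) (eps2 : eps ^+ 2 = 1).

Let epsN2 : (- eps) ^+ 2 = 1. Proof. by rewrite sqrrN. Qed.

(** The sign [eps] is the value of w ^+ q on the reflections placed first. *)
Definition dihedral_irr j : representation F G :=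
  if (j < q)%N then rot_repr ew q0 pq j
  else if j == q then
    linear_repr (G := G) (chi := fun=> 1) (erefl _) (fun _ _ _ _ => esym (mulr1 1))
  else if j == q.+1 then linear_repr (chi_sign1 ew) (chi_signM ew)
  else if j == q.+2 then linear_repr (chi_par1 ew q0 pq eps) (chi_parM ew pq eps2)
  else linear_repr (chi_par1 ew q0 pq (- eps)) (chi_parM ew pq epsN2).

Lemma dihedral_irr_rot j : (j < q)%N -> dihedral_irr j = rot_repr ew q0 pq j.
Proof. by rewrite /dihedral_irr => ->. Qed.

Lemma dihedral_irr0 : dihedral_irr q =
  linear_repr (G := G) (chi := fun=> 1) (erefl _) (fun _ _ _ _ => esym (mulr1 1)).
Proof. by rewrite /dihedral_irr ltnn eqxx. Qed.

Lemma dihedral_irr1 : dihedral_irr q.+1 = linear_repr (chi_sign1 ew) (chi_signM ew).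
Proof. by rewrite /dihedral_irr ltnNge leqnSn eqxx gtn_eqF. Qed.

Lemma dihedral_irr2 : dihedral_irr q.+2 =
  linear_repr (chi_par1 ew q0 pq eps) (chi_parM ew pq eps2).
Proof. by rewrite /dihedral_irr ifN -?leqNgt ?eqxx ?gtn_eqF //; lia. Qed.

Lemma dihedral_irr3 : dihedral_irr q.+3 =
  linear_repr (chi_par1 ew q0 pq (- eps)) (chi_parM ew pq epsN2).
Proof. by rewrite /dihedral_irr ifN -?leqNgt ?eqxx ?gtn_eqF //; lia. Qed.

Lemma tr_dihedral_sum (a : nat -> nat) s :
  \sum_(1 <= j < q.+4) \tr (dihedral_irr j s) *+ a j =
  \sum_(1 <= j < q) (if e s then 0 else w s ^+ j + (w s ^+ j)^-1) *+ a j
  + (1 *+ a q + (-1) ^+ e s *+ a q.+1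
     + (w s ^+ q * eps ^+ e s) *+ a q.+2 + (w s ^+ q * (- eps) ^+ e s) *+ a q.+3).
Proof.
rewrite !big_nat_recr //=.
rewrite dihedral_irr0 dihedral_irr1 dihedral_irr2 dihedral_irr3 !linear_repr_tr -!addrA.
congr (_ + _); apply: eq_big_nat => j /andP[_ jq].
by rewrite dihedral_irr_rot // rot_repr_tr.
Qed.

Lemma dihedral_irr_irr (z : F) j : z ^+ p = 1 ->
  (forall l, (1 <= l < q)%N -> z ^+ l.*2 != 1) -> (1 <= j)%N -> mx_irreducible (dihedral_irr j).
Proof.
move=> zp z2 j1; rewrite /dihedral_irr; case: ifP => [jq|_].
  by apply: rot_repr_irr zp _; apply: z2; rewrite j1 jq.
by do 3 (case: ifP => _; first exact: linear_repr_irr); exact: linear_repr_irr.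
Qed.

End Irr.

(** * Numberings of the conjugacy classes *)

Section Main.
Variables (R : realType) (d : nat) (lam : 'rV[R[i]%C]_d) (Klam : in_K lam).
Local Notation C := R[i]%C.
Local Notation G := (stab_group Klam).
Variables (psi : option C -> option C) (T : config_type) (p q m : nat).
Hypothesis (Lpsi : is_LFT psi) (q0 : (0 < q)%N) (pq : p = q.*2).
Variable L : seq C.
Hypothesis md : model_data lam psi T p m L.
Variables (e : 'S_(3 + d) -> bool) (w : 'S_(3 + d) -> C).
Hypothesis ew : dihedral_coords G p e w.
Hypothesis ewE : forall s, s \in G -> has_dih lam psi s (e s) (w s).

Let p0 : (0 < p)%N. Proof. by rewrite pq double_gt0. Qed.
Let zprim := zeta_prim R p0.

Lemma sqrt_ex (z : C) : exists y, y ^+ 2 = z.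
Proof. by exists (sqrtC z); rewrite sqrtCK. Qed.

Lemma oneN1 : (1 : C) != -1.
Proof. by rewrite -subr_eq0 opprK -mulr2n mulrn_eq0 oner_eq0. Qed.

Lemma psi_rotationE s l : s \in G ->
  (exists b : bool, psi \o Phi lam s =
     rotation ((-1) ^+ b * (2 * pi * l%:R / p%:R)) \o psi) <->
  ~~ e s && ((w s == zeta R p ^+ l) || (w s == (zeta R p ^+ l)^-1)).
Proof.
move=> Gs; have z0 := zeta_neq0 R p.
have rotE (b : bool) : rotation ((-1) ^+ b * (2 * pi * l%:R / p%:R)) =
    dih false (if b then (zeta R p ^+ l)^-1 else zeta R p ^+ l).
  by rewrite -cis_sign_zeta.
split=> [[b]|/andP[/negPf es H]].
  rewrite rotE => E.
  have nz : (if b then (zeta R p ^+ l)^-1 else zeta R p ^+ l) != 0.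
    by case: (b); rewrite ?invr_eq0 expf_neq0.
  have [-> ->] := has_dih_fun Lpsi (coord_neq0 ew q0 pq Gs) nz (ewE Gs) E.
  by case: (b); rewrite ?eqxx ?orbT.
exists (w s != zeta R p ^+ l); rewrite rotE.
have := ewE Gs; rewrite /has_dih es => ->.
by case: eqP H => [->|_ /= /eqP ->].
Qed.

Lemma nb_fixedE s : s \in G -> e s -> nb_fixed lam s = (w s ^+ q \in L).*2.
Proof.
move=> Gs es; apply: (nb_fixed_refl (Klam := Klam) Lpsi q0 pq (md_model md)) => //.
  exact: (coord_root ew).
by rewrite -es; apply: ewE.
Qed.

Definition rot_class l : {set 'S_(3 + d)} :=
  [set s in G | ~~ e s && ((w s == zeta R p ^+ l) || (w s == (zeta R p ^+ l)^-1))]%SET.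

(** By [class_refl] the reflections form two classes, the value of w ^+ q being 1
    on one and -1 on the other. *)
Definition refl_class (eps : C) : {set 'S_(3 + d)} :=
  [set s in G | e s && (w s ^+ q == eps)]%SET.

(** The reflections with w ^+ q = 1 come first: they are those whose fixed points
    are in A_p. *)
Definition std_class l : {set 'S_(3 + d)} :=
  if (l <= q)%N then rot_class l
  else if l == q.+1 then [set 1%g]%SET else refl_class ((-1) ^+ (l != q.+2)).

Lemma in_rot_class l s : (s \in rot_class l) =
  (s \in G) && (~~ e s && ((w s == zeta R p ^+ l) || (w s == (zeta R p ^+ l)^-1))).
Proof. by rewrite inE. Qed.

Lemma in_refl_class eps s : (s \in refl_class eps) = [&& s \in G, e s & w s ^+ q == eps].
Proof. by rewrite inE. Qed.

Lemma std_class_rot l : (1 <= l <= q)%N -> std_class l = rot_class l.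
Proof. by rewrite /std_class => /andP[_ ->]. Qed.

Lemma std_class_id : std_class q.+1 = [set 1%g]%SET.
Proof. by rewrite /std_class ltnn eqxx. Qed.

Lemma std_class_refl (b : bool) : std_class (q.+2 + b) = refl_class ((-1) ^+ b).
Proof.
rewrite /std_class ifN ?ifN; [|by lia|by lia].
by congr (refl_class (_ ^+ nat_of_bool _)); lia.
Qed.

Lemma std_index l : (1 <= l <= q.+3)%N ->
  [\/ (1 <= l <= q)%N, l = q.+1 | exists b : bool, l = (q.+2 + b)%N].
Proof.
move=> l3; have [lq|ql] := leqP l q; first by apply: Or31; lia.
have [l1|l1] := eqVneq l q.+1; first exact: Or32.
by apply: Or33; exists (l != q.+2); lia.
Qed.

Lemma std_class_inj i j s : (1 <= i <= q.+3)%N -> (1 <= j <= q.+3)%N ->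
  s \in std_class i -> s \in std_class j -> i = j.
Proof.
have rotP l : (1 <= l <= q)%N -> s \in std_class l -> ~~ e s /\ w s != 1.
  move=> lq; rewrite std_class_rot // in_rot_class => /andP[_ /andP[es ws]]; split=> //.
  have zl : zeta R p ^+ l != 1.
    by rewrite -(prim_order_dvd zprim); apply/negP => /dvdn_leq; lia.
  by case/orP: ws => /eqP ->; rewrite ?invr_eq1.
have idP : s \in std_class q.+1 -> ~~ e s /\ w s = 1.
  rewrite std_class_id finset.in_set1 => /eqP ->.
  by rewrite (coord_refl1 ew) (coord_root1 ew q0 pq).
have reflP (b : bool) : s \in std_class (q.+2 + b) -> e s /\ w s ^+ q = (-1) ^+ b.
  by rewrite std_class_refl in_refl_class => /and3P[_ es /eqP].
move=> /std_index[iq|->|[b ->]] /std_index[jq|->|[c ->]] // si sj.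
- move: si sj; rewrite !std_class_rot // !in_rot_class.
  move=> /andP[_ /andP[_ si]] /andP[_ /andP[_ sj]].
  apply: (zeta_eqX (R := R) q0 pq) => //.
  case/orP: si => /eqP si; case/orP: sj => /eqP sj; rewrite si in sj.
  + by left.
  + by right.
  + by right; rewrite -[LHS]invrK sj.
  + by left; apply: invr_inj.
- by have [_ /eqP] := rotP i iq si; have [_] := idP sj.
- by have [es _] := rotP i iq si; have [] := reflP c sj; rewrite (negPf es).
- by have [_ /eqP] := rotP j jq sj; have [_] := idP si.
- by have [es _] := idP si; have [] := reflP c sj; rewrite (negPf es).
- by have [es _] := rotP j jq sj; have [] := reflP b si; rewrite (negPf es).
- by have [es _] := idP sj; have [] := reflP b si; rewrite (negPf es).
have [_ wb] := reflP b si; have [_] := reflP c sj; rewrite wb => /eqP.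
by case: b c {si sj wb} => -[] //=; rewrite ?[-1 == _]eq_sym (negPf oneN1).
Qed.

Lemma refl_class_ex (b : bool) : exists s, s \in refl_class ((-1) ^+ b).
Proof.
have [z zp zq] : exists2 z : C, z ^+ p = 1 & z ^+ q = (-1) ^+ b.
  exists (zeta R p ^+ b); first by rewrite exprAC (prim_expr_order zprim) expr1n.
  by rewrite exprAC (zeta_half R q0 pq).
have [s Gs [es ws]] := coord_surj ew true zp.
by exists s; rewrite in_refl_class Gs es ws zq eqxx.
Qed.

Lemma std_class_ex l : (1 <= l <= q.+3)%N -> exists s, s \in std_class l.
Proof.
move=> /std_index[lq|->|[b ->]].
- have zp : (zeta R p ^+ l) ^+ p = 1 by rewrite exprAC (prim_expr_order zprim) expr1n.
  have [s Gs [es ws]] := coord_surj ew false zp.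
  by exists s; rewrite std_class_rot // in_rot_class Gs es ws eqxx.
- by exists 1%g; rewrite std_class_id finset.in_set1.
by rewrite std_class_refl; apply: refl_class_ex.
Qed.

Lemma refl_class_class (b : bool) : refl_class ((-1) ^+ b) \in classes G.
Proof.
have [s sb] := refl_class_ex b; have := sb; rewrite in_refl_class => /and3P[Gs es /eqP ws].
have -> : refl_class ((-1) ^+ b) = (s ^: G)%g; last exact: mem_classes.
by apply/setP => t; rewrite in_refl_class (class_refl ew q0 pq _ sqrt_ex Gs es) ws.
Qed.

Lemma std_numbering : class_numbering Klam psi T p std_class.
Proof.
rewrite /class_numbering; have -> : p./2 = q by rewrite pq doubleK.
have c2 : std_class q.+2 = refl_class 1 by have := std_class_refl false; rewrite addn0.
have c3 : std_class q.+3 = refl_class (-1) by have := std_class_refl true; rewrite addn1.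
split.
- move=> l lq s; rewrite std_class_rot // in_rot_class; split.
    by move=> /andP[Gs H]; split=> //; apply/psi_rotationE.
  by move=> [Gs /(psi_rotationE l Gs) H]; rewrite Gs.
- exact: std_class_id.
- rewrite c2 c3; split; first exact: (refl_class_class false).
  exact: (refl_class_class true).
- move=> i j Hi Hj E; have [s si] := std_class_ex Hi.
  by apply: (std_class_inj Hi Hj si); rewrite -E.
move=> HT; rewrite c2 c3; split=> s; rewrite in_refl_class => /and3P[Gs es /eqP ws].
  by rewrite nb_fixedE // ws (md_A md); case: HT => ->.
by rewrite nb_fixedE // ws (md_B md); case: HT => ->.
Qed.

(** A class of rotations or of the identity is already one of the first q + 1
    classes, so by injectivity the last two are classes of reflections. *)
Lemma numbering_refl K l : class_numbering Klam psi T p K -> (l == q.+2) || (l == q.+3) ->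
  exists2 eps : C, eps = 1 \/ eps = -1 &
    forall s, s \in K l = [&& s \in G, e s & w s ^+ q == eps].
Proof.
rewrite /class_numbering; have -> : p./2 = q by rewrite pq doubleK.
move=> [K1 K2 [K3 K3'] K4 _] lq.
have /imsetP[x Gx Kl] : K l \in classes G by case/orP: lq => /eqP ->.
have [ex|ex] := boolP (e x).
  exists (w x ^+ q) => [|s]; first exact: (coord_half ew pq).
  by rewrite Kl (class_refl ew q0 pq _ sqrt_ex Gx ex).
exfalso; have [x1|x1] := eqVneq (w x) 1.
  have : K l = K q.+1.
    rewrite K2 Kl; apply/setP => s.
    rewrite (class_rot ew q0 pq _ Gx ex) x1 invr1 orbb finset.in_set1.
    apply/and3P/eqP => [[Gs es /eqP ws]|->].
      apply: (coord_inj ew) => //; rewrite ?(coord_refl1 ew) //.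
        by rewrite (negPf es).
      by rewrite (coord_root1 ew q0 pq).
    by rewrite group1 (coord_refl1 ew) (coord_root1 ew q0 pq).
  by move/K4; lia.
have [k kq xk] := root_zeta q0 pq (coord_root ew Gx) x1.
have : K l = K k.
  apply/setP => s; rewrite Kl (class_rot ew q0 pq _ Gx ex).
  apply/idP/idP => [/and3P[Gs es ws]|].
    apply/K1 => //; split=> //; apply/psi_rotationE; rewrite // es /=.
    by case: xk ws => -> //; rewrite invrK orbC.
  move/(K1 _ kq) => [Gs /(psi_rotationE k Gs)/andP[es ws]]; rewrite Gs es /=.
  by case: xk => -> //; rewrite invrK orbC.
by move/K4; lia.
Qed.

(** The order of the last two classes is recorded by a sign, and the number of
    fixed points imposes it for the types where A_p occurs without B_p. *)
Lemma numbering_eps K : class_numbering Klam psi T p K ->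
  exists2 eps : C, eps = 1 \/ eps = -1 &
    [/\ forall s, s \in K q.+2 = [&& s \in G, e s & w s ^+ q == eps],
        forall s, s \in K q.+3 = [&& s \in G, e s & w s ^+ q == - eps] &
        T = T_AC \/ T = T_A2C -> eps = 1].
Proof.
move=> nK; have [|eps epsE KE] := numbering_refl (l := q.+2) nK; first by rewrite eqxx.
have [|eps' epsE' KE'] := numbering_refl (l := q.+3) nK; first by rewrite eqxx orbT.
have N : eps' = - eps.
  have [E|E] := eqVneq eps eps'.
    case: nK => _ _ _; have -> : p./2 = q by rewrite pq doubleK.
    move/(_ q.+2 q.+3) => H.
    suff : q.+2 = q.+3 by lia.
    by apply: H; [lia|lia|apply/setP => s; rewrite KE KE' E].
  by case: epsE epsE' E => [->|->] [->|->]; rewrite ?eqxx ?opprK.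
exists eps => //; split=> // [s|HT]; first by rewrite KE' N.
case: epsE => // E; exfalso.
have [s sE] := refl_class_ex true; move: (sE); rewrite in_refl_class => /and3P[Gs es /eqP ws].
have sK : s \in K q.+2 by rewrite KE Gs es ws E eqxx.
case: nK => _ _ _ _; have -> : p./2 = q by rewrite pq doubleK.
case/(_ HT) => /(_ s sK) + _; rewrite nb_fixedE // ws (md_B md).
by case: HT => ->.
Qed.

(** * Multiplicities *)

Fact jac_mx_repr : mx_repr G (jac lam).
Proof.
split=> [|s t Gs Gt]; first exact: jac1.
by apply: jacM => //; apply/eqP; rewrite -in_stab.
Qed.

(** The multiplicities of the two-dimensional representations are all equal, but
    for the first one which is smaller by one without the poles. *)
Lemma sum_nearly_const (x : nat -> C) (a : nat -> nat) N (b : bool) :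
  (forall j, (1 <= j < q)%N -> (a j + (j == 1) && b = N)%N) ->
  \sum_(1 <= j < q) x j *+ a j =
  (\sum_(1 <= j < q) x j) *+ N - (if (1 < q)%N && b then x 1 else 0).
Proof.
move=> aN; rewrite -sumrMnl.
have -> : (if (1 < q)%N && b then x 1 else 0) = \sum_(1 <= j < q) x j *+ ((j == 1) && b).
  have [q1|q1] := ltnP 1 q; last by rewrite big_geq.
  rewrite big_ltn // eqxx big1_seq ?addr0; first by case: b {aN}.
  by move=> j; rewrite mem_index_iota => /andP[_ /andP[j1 _]]; rewrite gtn_eqF.
rewrite -sumrB; apply: eq_big_nat => j /aN <-.
by rewrite mulrnDr addrK.
Qed.

Let natC (n : nat) : C := n%:R.

Section Vector.
Variable a : seq nat.
(** The multiplicity of the representation of index j; indices start at 1. *)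
Let a_ j := nth 0%N a j.-1.
Let N := (type_A T + type_B T + m.*2)%N.
Hypothesis size_a : size a = q.+3.
Hypothesis a_rot : forall j, (1 <= j < q)%N ->
  (a_ j + (j == 1) && ~~ type_poles T = N)%N.
Hypothesis a_sign : (a_ q + a_ q.+1 + 1 = N)%N.
Hypothesis a_par : (a_ q.+2 + a_ q.+3 + ((q == 1) && ~~ type_poles T).*2 = N)%N.
Hypothesis a_A : (a_ q + a_ q.+2 + (type_A T).*2 = 1 + a_ q.+1 + a_ q.+3)%N.
Hypothesis a_B : (a_ q + a_ q.+3 + (type_B T).*2 = 1 + a_ q.+1 + a_ q.+2)%N.

(** The five conditions on the multiplicities come from the values of the
    characters.  At rotations w ^+ q takes both signs, whence [a_rot], [a_sign]
    and [a_par]; for q = 1 the missing term w + 1 / w is 2 w and is taken from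
    [a_par].  [a_A] and [a_B] are the traces at the two classes of reflections.
    The trace at the identity follows from the number of points. *)
Lemma tr_jac_sum (eps : C) (eps2 : eps ^+ 2 = 1) s :
  (eps = 1 \/ eps = -1) -> (T = T_AC \/ T = T_A2C -> eps = 1) -> s \in G ->
  \tr (jac lam s) = \sum_(1 <= j < q.+4) \tr (dihedral_irr ew q0 pq eps2 j s) *+ a_ j.
Proof.
move=> eps1 epsT Gs; rewrite tr_dihedral_sum.
have wp := coord_root ew Gs; have hs := ewE Gs.
have sA : (a_ q)%:R + (a_ q.+1)%:R + 1 = N%:R :> C by rewrite -a_sign !natrD.
have pA : (a_ q.+2)%:R + (a_ q.+3)%:R + ((q == 1) && ~~ type_poles T).*2%:R = N%:R :> C.
  by rewrite -[in RHS]a_par !natrD.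
have aA := congr1 natC a_A; have aB := congr1 natC a_B.
rewrite /natC !natrD in aA aB.
case es: (e s).
  rewrite es in hs.
  rewrite (mxtrace_jac_dih Lpsi q0 pq (md_model md) Gs wp hs) //.
  rewrite big1 => [|j _]; last by rewrite mul0rn.
  rewrite add0r !expr1.
  (* When eps = -1 the two classes are exchanged, which is harmless as then A_p
     and B_p occur together or not at all. *)
  have AB : eps = -1 -> type_A T = type_B T.
    move=> E; have := oneN1; rewrite -E eq_sym.
    by case HT : T epsT => //= H; rewrite H ?eqxx; auto.
  have E1 : (1 \in L) = type_A T := md_A md.
  have E2 : (-1 \in L) = type_B T := md_B md.
  have q1 : (a_ q)%:R = 1 + (a_ q.+1)%:R + (a_ q.+3)%:R - (a_ q.+2)%:R - (type_A T).*2%:R :> C.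
    by rewrite -[1 + _ + _]aA; ring.
  have q2 : (a_ q)%:R = 1 + (a_ q.+1)%:R + (a_ q.+2)%:R - (a_ q.+3)%:R - (type_B T).*2%:R :> C.
    by rewrite -[1 + _ + _]aB; ring.
  rewrite -[_ *+ a_ q.+1]mulr_natr -[_ *+ a_ q.+2]mulr_natr -[_ *+ a_ q.+3]mulr_natr.
  case: (coord_half ew pq Gs) => ->; case: eps1 => eE; rewrite eE ?E1 ?E2.
  - by rewrite q1; ring.
  - by rewrite AB // q2; ring.
  - by rewrite q2; ring.
  - by rewrite -AB // q1; ring.
rewrite es in hs; rewrite !expr0 !mulr1.
rewrite (sum_nearly_const _ a_rot).
have [w1|w1] := eqVneq (w s) 1; last first.
  rewrite (mxtrace_jac_dih Lpsi q0 pq (md_model md) Gs wp hs) ?w1 ?orbT //.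
  rewrite sum_cos //; last by rewrite -pq.
  rewrite -[_ *+ N]mulr_natr -[_ *+ a_ q.+2]mulr_natr -[_ *+ a_ q.+3]mulr_natr.
  have -> : (a_ q)%:R = N%:R - 1 - (a_ q.+1)%:R :> C by rewrite -sA; ring.
  have -> : (a_ q.+2)%:R = N%:R - ((q == 1) && ~~ type_poles T).*2%:R - (a_ q.+3)%:R :> C.
    by rewrite -pA; ring.
  case: (type_poles T); first by rewrite !andbF /= double0; ring.
  rewrite !andbT; have [q1|q1] := eqVneq q 1.
    rewrite q1 /= expr1; have -> : (w s)^-1 = w s.
      have w0 := coord_neq0 ew q0 pq Gs.
      by apply: (mulfI w0); rewrite divff // -expr2; move: wp; rewrite {1}pq q1.
    by rewrite -[1.*2]/2%N; ring.
  have -> : (1 < q)%N by rewrite ltn_neqAle eq_sym q1.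
  by rewrite expr1 /= double0; ring.
have -> : s = 1%g.
  apply: (coord_inj ew); rewrite ?group1 // ?(coord_refl1 ew) //.
  by rewrite (coord_root1 ew q0 pq).
rewrite (coord_root1 ew q0 pq) jac1 // mxtrace1 expr1n.
rewrite (eq_bigr (fun=> 2)) => [|j _]; last by rewrite expr1n invr1.
have cp := card_points Klam Lpsi q0 pq (md_uniq md) (md_neq0 md) (md_model md).
rewrite (md_size md) -/N in cp.
have {cp} : (3 + d = q.*2 * N + (type_poles T).*2)%N by rewrite -pq.
move=> /(congr1 natC); rewrite /natC !natrD natrM => cp.
rewrite big_const_nat iter_addr_0 expr1n invr1.
have -> : 2 *+ (q - 1) *+ N = (q.*2%:R - 2) * N%:R :> C.
  by rewrite -[_ *+ N]mulr_natr -[_ *+ (q - 1)]mulr_natr -muln2 natrM natrB //; ring.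
have -> : d%:R = q.*2%:R * N%:R + (type_poles T).*2%:R - 3 :> C by rewrite -cp; ring.
have -> : (a_ q)%:R = N%:R - 1 - (a_ q.+1)%:R :> C by rewrite -sA; ring.
have -> : (a_ q.+2)%:R = N%:R - ((q == 1) && ~~ type_poles T).*2%:R - (a_ q.+3)%:R :> C.
  by rewrite -pA; ring.
case: (type_poles T); first by rewrite !andbF /= double0 -[1.*2]/2%N; ring.
rewrite !andbT; have [q1|q1] := eqVneq q 1; first by rewrite q1 /= double0 -[1.*2]/2%N; ring.
have -> : (1 < q)%N by rewrite ltn_neqAle eq_sym q1.
by rewrite /= double0; ring.
Qed.

Lemma multiplicity_vectorI : multiplicity_vector Klam psi T p a.
Proof.
have p2 : p./2 = q by rewrite pq doubleK.
split; first by rewrite size_a pq; lia.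
split; first by exists std_class; exact: std_numbering.
move=> K nK; have [eps eps1 [K2 K3 epsT]] := numbering_eps nK.
have eps2 : eps ^+ 2 = 1 by case: eps1 => ->; rewrite ?expr1n ?sqrrN ?expr1n.
exists (dihedral_irr ew q0 pq eps2); split; last first.
  exists (MxRepresentation jac_mx_repr); split=> //.
  apply: eq_mxtrace_rsim => [|s Gs]; first exact: pchar_num.
  rewrite mxtrace_dsum_muln size_a.
  exact: tr_jac_sum.
have K1 l s : (1 <= l <= q)%N -> s \in K l ->
    [/\ s \in G, e s = false & w s = zeta R p ^+ l \/ w s = (zeta R p ^+ l)^-1].
  case: nK => H _ _ _ _ lq sl; rewrite p2 in H.
  have [Gs /(psi_rotationE l Gs)/andP[/negPf es ws]] := iffLR (H l lq s) sl.
  by split=> //; case/orP: ws => /eqP; [left|right].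
have zp : zeta R p ^+ p = 1 by exact: (prim_expr_order zprim).
have zq := zeta_half R q0 pq.
rewrite /irr_numbering p2; split.
- move=> j /andP[j1 _]; apply: (dihedral_irr_irr _ _ _ _ zp) => // l /andP[l1 lq].
  by rewrite -(prim_order_dvd zprim) pq; apply/negP => /dvdn_leq; lia.
- move=> l /andP[l1 lq]; have {}lq : (l < q)%N by lia.
  rewrite dihedral_irr_rot //; split=> // [k s kq sk|s|s].
  + have [Gs es ws] := K1 _ _ kq sk; rewrite rot_repr_tr es.
    have -> : 2 * k%:R * l%:R * pi / p%:R = (l * k)%:R * (2 * pi / p%:R) :> R.
      by rewrite natrM; ring.
    rewrite -cisDV cis_natmul mulnC exprM.
    by case: ws => ->; rewrite ?exprVn ?invrK // addrC.
  + by rewrite K2 => /and3P[Gs es _]; rewrite rot_repr_tr es.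
  + by rewrite K3 => /and3P[Gs es _]; rewrite rot_repr_tr es.
- by rewrite dihedral_irr0.
split.
- rewrite dihedral_irr1; split=> // [k s kq sk|s|s]; rewrite linear_repr_tr /chi_sign.
  + by have [_ -> _] := K1 _ _ kq sk.
  + by rewrite K2 => /and3P[_ -> _].
  + by rewrite K3 => /and3P[_ -> _].
- rewrite dihedral_irr2; split=> // [k s kq sk|s|s]; rewrite linear_repr_tr /chi_par.
  + have [_ -> ws] := K1 _ _ kq sk; rewrite expr0 mulr1.
    by case: ws => ->; rewrite ?exprVn exprAC zq // invr_sign.
  + by rewrite K2 => /and3P[_ -> /eqP ->]; rewrite -expr2.
  + by rewrite K3 => /and3P[_ -> /eqP ->]; rewrite expr1 mulNr -expr2 eps2.
- rewrite dihedral_irr3; split=> // [k s kq sk|s|s]; rewrite linear_repr_tr /chi_par.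
  + have [_ -> ws] := K1 _ _ kq sk; rewrite expr0 mulr1.
    by case: ws => ->; rewrite ?exprVn exprAC zq // invr_sign.
  + by rewrite K2 => /and3P[_ -> /eqP ->]; rewrite expr1 mulrN -expr2 eps2.
  + by rewrite K3 => /and3P[_ -> /eqP ->]; rewrite expr1 mulrNN -expr2 eps2.
Qed.

End Vector.
End Main.

Local Close Scope ring_scope.
Local Open Scope nat_scope.

(** [multiplicity_vectorI] for a vector cut after the multiplicities [rots] of the
    two-dimensional representations. *)
Lemma has_type_multiplicity (R : realType) (d p m : nat) (lam : 'rV[R[i]%C]_d)
    (Klam : in_K lam) (psi : option R[i]%C -> option R[i]%C) (T : config_type)
    (rots : seq nat) (a1 a2 a3 a4 : nat) :
  let N := type_A T + type_B T + m.*2 in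
  2 <= p -> ~~ odd p -> #|stab_group Klam| = p.*2 ->
  has_type lam psi T p m ->
  size rots = p./2.-1 ->
  (forall j, j < p./2.-1 -> nth 0 rots j + (j == 0) && ~~ type_poles T = N) ->
  a1 + a2 + 1 = N ->
  a3 + a4 + ((p == 2) && ~~ type_poles T).*2 = N ->
  a1 + a3 + (type_A T).*2 = 1 + a2 + a4 ->
  a1 + a4 + (type_B T).*2 = 1 + a2 + a3 ->
  multiplicity_vector Klam psi T p (rots ++ [:: a1; a2; a3; a4]).
Proof.
move=> N p2 p_even cardG lamT size_rots rotsE E1 E2 E3 E4.
have pq : p = p./2.*2 by rewrite even_halfK.
have q0 : 0 < p./2 by lia.
have [Lpsi _] := lamT; have [L md] := has_type_data (ltnW p2) lamT.
have [e [w [ew ewE]]] := exists_dihedral_coords Lpsi q0 pq (md_inv md) (md_model md) cardG.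
have nth_tail k : nth 0 (rots ++ [:: a1; a2; a3; a4]) (p./2.-1 + k) = nth 0 [:: a1; a2; a3; a4] k.
  by rewrite nth_cat size_rots ltnNge leq_addr /= addKn.
have [t1 t2 t3 t4] := (@And4 _ _ _ _ (nth_tail 0) (nth_tail 1) (nth_tail 2) (nth_tail 3)).
rewrite /= !(addn0, addn1, addn2, addn3) prednK // in t1 t2 t3 t4.
apply: (multiplicity_vectorI Lpsi q0 pq md ew ewE) => [|j /andP[j1 jq]||||] //=;
  rewrite ?t1 ?t2 ?t3 ?t4 //.
- by rewrite size_cat size_rots /= addn4 prednK.
- rewrite nth_cat size_rots ifT; last by lia.
  have -> : (j == 1) = (j.-1 == 0) by lia.
  by apply: rotsE; lia.
- by have -> : (p./2 == 1) = (p == 2) by lia.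
Qed.

Lemma has_type_card (R : realType) (d p m : nat) (lam : 'rV[R[i]%C]_d)
    (Klam : in_K lam) (psi : option R[i]%C -> option R[i]%C) (T : config_type) :
  2 <= p -> ~~ odd p -> has_type lam psi T p m ->
  3 + d = p * (type_A T + type_B T + m.*2) + (type_poles T).*2.
Proof.
move=> p2 p_even lamT; have pq : p = p./2.*2 by rewrite even_halfK.
have q0 : 0 < p./2 by lia.
have [Lpsi _] := lamT; have [L md] := has_type_data (ltnW p2) lamT.
by rewrite -(md_size md) (card_points Klam Lpsi q0 pq (md_uniq md) (md_neq0 md) (md_model md)).
Qed.

Theorem theorem20 (R : realType) (d p m : nat) (hn : 5 <= 3 + d)
    (hp : 2 <= p) (p_even : ~~ odd p)
    (lam : 'rV[R[i]%C]_d) (Klam : in_K lam)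
    (hD : (stab_group Klam \isog [set: dihedral_gtype p.*2]%SET)%g)
    (psi : option R[i]%C -> option R[i]%C) :
  let mult := multiplicity_vector Klam psi in
  (has_type lam psi T_C p m ->
     [/\ p = 2 -> mult T_C p [:: m; m - 1; m - 1; m - 1],
         p = 4 -> mult T_C p [:: 2 * m - 1; m; m - 1; m; m] &
         6 <= p -> mult T_C p ([:: 2 * m - 1] ++ nseq (p./2 - 2) (2 * m)
                               ++ [:: m; m - 1; m; m])]) /\
  (has_type lam psi T_AC p m ->
     [/\ p = 2 -> mult T_AC p [:: m; m; m - 1; m],
         p = 4 -> mult T_AC p [:: 2 * m; m; m; m; m + 1] &
         6 <= p -> mult T_AC p ([:: 2 * m] ++ nseq (p./2 - 2) (2 * m + 1)
                                ++ [:: m; m; m; m + 1])]) /\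
  (has_type lam psi T_ABC p m ->
     [/\ p = 2 -> mult T_ABC p [:: m; m + 1; m; m],
         p = 4 -> mult T_ABC p [:: 2 * m + 1; m; m + 1; m + 1; m + 1] &
         6 <= p -> mult T_ABC p ([:: 2 * m + 1] ++ nseq (p./2 - 2) (2 * m + 2)
                                 ++ [:: m; m + 1; m + 1; m + 1])]) /\
  (has_type lam psi T_2C p m ->
     (p = 2 -> mult T_2C p [:: m; m - 1; m; m]) /\
     (4 <= p -> mult T_2C p (nseq (p./2 - 1) (2 * m) ++ [:: m; m - 1; m; m]))) /\
  (has_type lam psi T_A2C p m ->
     (p = 2 -> mult T_A2C p [:: m; m; m; m + 1]) /\
     (4 <= p -> mult T_A2C p (nseq (p./2 - 1) (2 * m + 1)
                              ++ [:: m; m; m; m + 1]))) /\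
  (has_type lam psi T_AB2C p m ->
     (p = 2 -> mult T_AB2C p [:: m; m + 1; m + 1; m + 1]) /\
     (4 <= p -> mult T_AB2C p (nseq (p./2 - 1) (2 * m + 2)
                               ++ [:: m; m + 1; m + 1; m + 1]))).
Proof.
move=> mult.
have cardG : #|stab_group Klam| = p.*2.
  by rewrite (card_isog hD) card_dihedral.
have mk T rots a1 a2 a3 a4 :=
  @has_type_multiplicity R d p m lam Klam psi T rots a1 a2 a3 a4 hp p_even cardG.
(* The vectors have three shapes, with no, one or more two-dimensional
   representations. *)
have rots_cons x y N (b : bool) : x + b = N -> y = N ->
    forall j, j < p./2.-1 -> nth 0 (x :: nseq (p./2 - 2) y) j + (j == 0) && b = N.
  move=> xN yN [|j] jq; first by rewrite /= -xN; case: b {xN}.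
  by rewrite /= nth_nseq ifT ?addn0 //; lia.
have rots_nseq y N : y = N ->
    forall j, j < p./2.-1 -> nth 0 (nseq (p./2 - 1) y) j + (j == 0) && false = N.
  by move=> yN j jq; rewrite nth_nseq ifT ?andbF ?addn0 //; lia.
have case2 T a1 a2 a3 a4 : p = 2 ->
    let N := type_A T + type_B T + m.*2 in
    has_type lam psi T p m -> a1 + a2 + 1 = N -> a3 + a4 + (~~ type_poles T).*2 = N ->
    a1 + a3 + (type_A T).*2 = 1 + a2 + a4 -> a1 + a4 + (type_B T).*2 = 1 + a2 + a3 ->
    mult T p [:: a1; a2; a3; a4].
  by move=> E N lamT E1 E2 E3 E4; apply: (mk T [::]); rewrite //= E.
have case4 T b a1 a2 a3 a4 : p = 4 ->
    let N := type_A T + type_B T + m.*2 in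
    has_type lam psi T p m -> b + ~~ type_poles T = N -> a1 + a2 + 1 = N -> a3 + a4 = N ->
    a1 + a3 + (type_A T).*2 = 1 + a2 + a4 -> a1 + a4 + (type_B T).*2 = 1 + a2 + a3 ->
    mult T p [:: b; a1; a2; a3; a4].
  move=> E N lamT E0 E1 E2 E3 E4; apply: (mk T [:: b]); rewrite //= E ?addn0 //.
  by case.
have caseC T b c a1 a2 a3 a4 : 6 <= p ->
    let N := type_A T + type_B T + m.*2 in
    has_type lam psi T p m -> b + ~~ type_poles T = N -> c = N ->
    a1 + a2 + 1 = N -> a3 + a4 = N ->
    a1 + a3 + (type_A T).*2 = 1 + a2 + a4 -> a1 + a4 + (type_B T).*2 = 1 + a2 + a3 ->
    mult T p ([:: b] ++ nseq (p./2 - 2) c ++ [:: a1; a2; a3; a4]).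
  move=> p6 N lamT Eb Ec E1 E2 E3 E4; rewrite catA; apply: mk => //.
  - by rewrite /= size_nseq; lia.
  - exact: rots_cons.
  - by rewrite gtn_eqF ?addn0 //; lia.
have caseP T c a1 a2 a3 a4 : 4 <= p -> type_poles T ->
    let N := type_A T + type_B T + m.*2 in
    has_type lam psi T p m -> c = N -> a1 + a2 + 1 = N -> a3 + a4 = N ->
    a1 + a3 + (type_A T).*2 = 1 + a2 + a4 -> a1 + a4 + (type_B T).*2 = 1 + a2 + a3 ->
    mult T p (nseq (p./2 - 1) c ++ [:: a1; a2; a3; a4]).
  move=> p4 polesT N lamT Ec E1 E2 E3 E4; apply: mk; rewrite ?polesT //.
  - by rewrite size_nseq subn1.
  - exact: rots_nseq.
  - by rewrite andbF addn0.
split; [|split; [|split; [|split; [|split]]]]; move=> lamT; have [_ [m1 _]] := lamT;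
  have nE := has_type_card Klam hp p_even lamT; rewrite /min_orbits in m1; split => H.
(* For type A+mC with p = 2 the vector contains m - 1: m is positive because
   there are at least five points. *)
all: [> apply: case2 | apply: case4 | apply: caseC
      | apply: case2 | apply: case4 | apply: caseC
      | apply: case2 | apply: case4 | apply: caseC
      | apply: case2 | apply: caseP
      | apply: case2 | apply: caseP
      | apply: case2 | apply: caseP]; rewrite //=; move: nE; rewrite ?H /=; lia.
Qed.
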